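(* Let $P\subset\mathbb{R}^m$ be a convex polytope with non-empty interior $P^o$. (i) Let $S\subset P$ be a finite set whose convex hull is $P$, and let $c:S\to\mathbb{R}_{>0}$ be a function. Let $m_{S,c,\alpha}$ ($\alpha\in S$) be the continuous functions on $P$ which on $P^o$ are given by $$m_{S,c,\alpha}(x)=\frac{c(\alpha)e^{\langle\alpha,\tau_{S,c}(x)\rangle}}{\sum_{\beta\in S}c(\beta)e^{\langle\beta,\tau_{S,c}(x)\rangle}}.$$ Then the section $\mathcal{B}_{S,c}:P\to\mathcal{M}(P)$ defined by $\mathcal{B}_{S,c}(x)=\sum_{\alpha\in S}m_{S,c,\alpha}(x)\delta_\alpha$ is a finitely supported Bernstein measure. (ii) Conversely, if $\mathcal{B}$ is a finitely supported Bernstein measure on $P$ with support $S$, then there exists a weight function $c:S\to\mathbb{R}_{>0}$ such that $\mathcal{B}=\mathcal{B}_{S,c}$.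
   Context: $\mathcal{M}(P)$ is the set of Borel probability measures on $P$ with the weak-$*$ topology; $b(\mu)=\int z\,d\mu(z)$ is the barycenter; $C(P)$ is the space of continuous functions on $P$. Bernstein measure: a continuous map $\mathcal{B}:P\to\mathcal{M}(P)$, $\mathcal{B}(x)=d\mathcal{B}_x$, with $b(\mathcal{B}(x))=x$ for all $x\in P$ such that (1) for every $f\in C(P)$ the function $B(f)(x)=\int_P f\,d\mathcal{B}_x$ belongs to $C^\infty(P^o)\cap C(P)$; (2) there is a smooth map $K:P^o\to\mathrm{Sym}(m,\mathbb{R})$ (real symmetric $m\times m$ matrices) with $\nabla B(f)(x)=\int_P f(z)K(x)(z-x)\,d\mathcal{B}_x(z)$ for all $f\in C(P)$, $x\in P^o$. Finitely supported: a Bernstein measure $\mathcal{B}$ is finitely supported with support $S$ if $S\subset P$ is a finite set with $\mathrm{supp}(\mathcal{B}(x))=S$ for all $x\in P^o$ and $\mathrm{supp}(\mathcal{B}(x))\subset S$ for all $x\in P$. For $S,c$ as in (i), the map $\mu_{S,c}:\mathbb{R}^m\to\mathbb{R}^m$, $\mu_{S,c}(\tau)=\sum_{\alpha\in S}\frac{c(\alpha)e^{\langle\alpha,\tau\rangle}}{\sum_{\beta\in S}c(\beta)e^{\langle\beta,\tau\rangle}}\alpha$, is a diffeomorphism of $\mathbb{R}^m$ onto $P^o$ (a well-known fact), and $\tau_{S,c}:P^o\to\mathbb{R}^m$ denotes its inverse. The functions $m_{S,c,\alpha}$, defined first on $P^o$, extend (uniquely) to continuous functions on $P$, still denoted $m_{S,c,\alpha}$.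 $\langle\cdot,\cdot\rangle$ is the Euclidean inner product and $\delta_\alpha$ the Dirac measure at $\alpha$. *)

(* Defs.v *)
From HB Require Import structures.
From mathcomp Require Import all_boot all_order all_algebra finmap.
From mathcomp Require Import all_classical all_reals all_analysis.
Set Implicit Arguments.
Unset Strict Implicit.
Unset Printing Implicit Defensive.
Import Order.TTheory GRing.Theory Num.Theory.
Import numFieldNormedType.Exports.
Local Open Scope classical_set_scope.
Local Open Scope ring_scope.

Section Bernstein.
Context {R : realType} {m : nat}.
Local Notation V := 'rV[R]_m.

Definition dotp (u v : V) : R := \sum_(i < m) u 0 i * v 0 i.

Definition convex_hull (A : set V) : set V := smallest (@convex_set R V) A.

Definition polytope (P : set V) : Prop :=
  exists F : {fset V}, P = convex_hull [set` F].

(** [Ck_on U k f] is meant for open [U], where [derive f ^~ v] at points of [U]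
    depends only on the restriction of [f] to [U]. *)
Fixpoint Ck_on (W : normedModType R) (U : set V) (k : nat) (f : V -> W) : Prop :=
  match k with
  | 0%N => forall x, U x -> {for x, continuous f}
  | k'.+1 => (forall x, U x -> differentiable f x) /\
             (forall v : V, Ck_on U k' (fun x => 'D_v f x))
  end.

Definition smooth_on (W : normedModType R) (U : set V) (f : V -> W) : Prop :=
  forall k, Ck_on U k f.

Definition grad (f : V -> R) (x : V) : V := \row_i 'D_(delta_mx 0 i) f x.

Definition borelV := g_sigma_algebraType (@open V).

Definition vintegral (mu : probability borelV R) (D : set V) (g : V -> V) : V :=
  \row_i \int[mu]_(z in D) g z 0 i.

(** [C(P)]: a function is represented by any extension to the ambient space,
    whose values outside [P] are never used. *)
Record contfun (P : set V) := ContFun {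
  contfun_fun :> V -> R ;
  contfun_cont : {within P, continuous contfun_fun} }.

(** [M(P)]: Borel probability measures on [P], seen as Borel probability
    measures on the ambient space carried by [P]. *)
Record prob_on (P : set V) := ProbOn {
  prob_on_measure :> probability borelV R ;
  prob_on_carried : prob_on_measure P = 1%E }.

Section WeakStar.
Variable P : set V.

HB.instance Definition _ := gen_eqMixin (prob_on P).
HB.instance Definition _ := gen_choiceMixin (prob_on P).

Definition pairing (mu : prob_on P) : {ptws contfun P -> R} :=
  fun f => \int[prob_on_measure mu]_(z in P) f z.

(** The weak-* topology: the coarsest one making [mu |-> \int f dmu]
    continuous for every [f] in [C(P)]. *)
HB.instance Definition _ :=
  Topological.copy (prob_on P) (initial_topology pairing).

End WeakStar.

Definition barycenter (P : set V) (mu : prob_on P) : V :=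
  vintegral mu P id.

Definition supp (mu : probability borelV R) : set V :=
  [set x | forall U : set V, open U -> U x -> (0 < mu U)%E].

Definition Bop (P : set V) (B : V -> prob_on P) (f : V -> R) (x : V) : R :=
  \int[prob_on_measure (B x)]_(z in P) f z.

(** A map defined on [P] is represented by a function on the ambient space,
    whose values outside [P] are irrelevant. Vectors being rows, a matrix [K]
    acts on [v] as [(K *m v^T)^T]. *)
Definition bernstein_measure (P : set V) (B : V -> prob_on P) : Prop :=
  [/\ {within P, continuous B},
      forall x, P x -> barycenter (B x) = x,
      forall f : contfun P,
        smooth_on P° (Bop B f) /\ {within P, continuous (Bop B f)}
    & exists K : V -> 'M[R]_m,
      [/\ forall x, P° x -> (K x)^T = K x,
          smooth_on P° K
        & forall (f : contfun P) (x : V), P° x ->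
            grad (Bop B f) x =
            vintegral (B x) P (fun z => f z *: (K x *m (z - x)^T)^T)]].

Definition finitely_supported (P : set V) (B : V -> prob_on P) (S : {fset V}) :
    Prop :=
  [/\ [set` S] `<=` P,
      forall x, P° x -> supp (B x) = [set` S]
    & forall x, P x -> supp (B x) `<=` [set` S]].

Section Toric.
Variables (P : set V) (S : {fset V}) (c : S -> R).

Definition weight (tau : V) (a : S) : R :=
  c a * expR (dotp (val a) tau)
    / (\sum_(b : S) c b * expR (dotp (val b) tau)).

Definition mu_Sc (tau : V) : V := \sum_(a : S) weight tau a *: val a.

Definition tau_Sc : V -> V := 'pinv_(fun=> 0) [set: V] mu_Sc.

(** The continuous extension to [P] of the density given on [P°] through
    [tau_Sc]; it is determined on [P] only. *)
Definition m_Sc (a : S) : V -> R :=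
  xget (fun=> 0) [set g : V -> R | {within P, continuous g} /\
                    forall x, P° x -> g x = weight (tau_Sc x) a].

Definition B_Sc (x : V) (A : set borelV) : \bar R :=
  (\sum_(a : S) (m_Sc a x)%:E * \d_(val a : borelV) A)%E.

(** Equality of measures is equality on Borel sets: the values a library
    measure takes on other sets carry no meaning. *)
Definition is_B_Sc (B : V -> prob_on P) : Prop :=
  forall x, P x -> forall A : set borelV, measurable A -> B x A = B_Sc x A.

End Toric.

End Bernstein.

(* Main.v *)
(** Write [weight c t] for the Gibbs weights and [mu_Sc c t] for their barycenter. The
    function [ln (weight c t a) - ln (c a)] of [a] is affine, so its mean against a
    probability on [S] depends on the barycenter only. Together with the strict
    monotonicity of [ln] this gives the injectivity of [mu_Sc]; surjectivity onto [P°]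
    is the existence of a minimum of the coercive function
    [t |-> \sum_a c a * expR (dotp (a - x) t)].

    The same affine identity controls the boundary: if the weights over interior points
    converge to [p] along an ultrafilter converging to [x], then [p] has the largest
    support among the barycentric coordinates of [x], and [ln (p / c)] has the same mean
    against all of them. There is only one such [p], so the weights extend continuously.

    Inside [P°] the derivative of [mu_Sc] is the covariance of the weights, whose inverse
    is the matrix [K] of a Bernstein measure.

    Conversely, the masses [M a] of a finitely supported Bernstein measure satisfy
    [grad (ln (M a)) = K (a - x)]. Hence a linear relation between the vectors [a - a0]
    makes the same combination of the functions [ln (M a / M a0)] constant, i.e.
    [ln (M a / M a0)] is, up to a constant, the pairing of [a - a0] with a vector [t]
    depending on the point only. *)

Require Import Defs.
From mathcomp Require Import all_boot all_order all_algebra finmap.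
From mathcomp Require Import all_classical all_reals all_analysis.
From mathcomp Require Import measurable_realfun ring lra.
Set Implicit Arguments.
Unset Strict Implicit.
Unset Printing Implicit Defensive.
Import Order.TTheory GRing.Theory Num.Theory.
Import numFieldNormedType.Exports.
Local Open Scope classical_set_scope.
Local Open Scope ring_scope.

Lemma cvg_finsum {R : numFieldType} {W : normedModType R} {T : Type}
    (F : set_system T) {FF : Filter F} (I : finType) (f : I -> T -> W)
    (l : I -> W) :
  (forall i, f i x @[x --> F] --> l i) ->
  \sum_i f i x @[x --> F] --> \sum_i l i.
Proof. by move=> fl; apply: cvg_big => [|i _]; [exact: add_continuous|exact: fl]. Qed.

(** * Inner product of row vectors *)

Section DotProduct.
Context {R : realType} {m : nat}.
Implicit Types u v w : 'rV[R]_m.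

Lemma dotpDl u v w : dotp (u + v) w = dotp u w + dotp v w.
Proof. by rewrite /dotp -big_split; apply: eq_bigr => i _; rewrite mxE mulrDl. Qed.

Lemma dotpDr u v w : dotp u (v + w) = dotp u v + dotp u w.
Proof. by rewrite /dotp -big_split; apply: eq_bigr => i _; rewrite mxE mulrDr. Qed.

Lemma dotpZl (k : R) u v : dotp (k *: u) v = k * dotp u v.
Proof. by rewrite /dotp mulr_sumr; apply: eq_bigr => i _; rewrite mxE mulrA. Qed.

Lemma dotpC u v : dotp u v = dotp v u.
Proof. by apply: eq_bigr => i _; rewrite mulrC. Qed.

Lemma dotpZr (k : R) u v : dotp u (k *: v) = k * dotp u v.
Proof. by rewrite dotpC dotpZl dotpC. Qed.

Lemma dotpNl u v : dotp (- u) v = - dotp u v.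
Proof. by rewrite -scaleN1r dotpZl mulN1r. Qed.

Lemma dotpBl u v w : dotp (u - v) w = dotp u w - dotp v w.
Proof. by rewrite dotpDl dotpNl. Qed.

Lemma dotpBr u v w : dotp u (v - w) = dotp u v - dotp u w.
Proof. by rewrite dotpC dotpBl !(dotpC _ u). Qed.

Lemma dotp0l v : dotp 0 v = 0.
Proof. by rewrite /dotp big1// => i _; rewrite mxE mul0r. Qed.

Lemma dotp_suml (I : finType) (F : I -> 'rV[R]_m) v :
  dotp (\sum_i F i) v = \sum_i dotp (F i) v.
Proof. by elim/big_rec2 : _ => [|i y1 y2 _ <-]; rewrite ?dotp0l ?dotpDl. Qed.

Lemma dotp_delta u i : dotp u (delta_mx 0 i) = u 0 i.
Proof.
rewrite /dotp (bigD1 i)//= mxE !eqxx mulr1 big1 ?addr0// => j ji.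
by rewrite mxE (negbTE ji) andbF mulr0.
Qed.

Lemma dotp_eq0 u : (forall v, dotp u v = 0) -> u = 0.
Proof. by move=> u0; apply/rowP => i; rewrite -dotp_delta u0 mxE. Qed.

Lemma mulmx_trmx_dotp u v : u *m v^T = (dotp u v)%:M.
Proof.
by apply/matrixP => i j; rewrite !ord1 !mxE mulr1n; apply: eq_bigr => k _; rewrite mxE.
Qed.

Lemma dotp_mulmx u v (A : 'M[R]_m) : dotp (u *m A) v = dotp u (v *m A^T).
Proof.
have : (u *m A) *m v^T = u *m (v *m A^T)^T by rewrite trmx_mul trmxK mulmxA.
by rewrite !mulmx_trmx_dotp => /matrixP/(_ 0 0); rewrite !mxE !mulr1n.
Qed.

Lemma dotp_continuousr u : continuous (dotp u).
Proof.
move=> v; apply: (@cvg_finsum _ _ _ (nbhs v)) => i /=.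
by apply: cvgM; [exact: cvg_cst|exact: coord_continuous].
Qed.

End DotProduct.

(** * Convex hulls of finite sets: barycentric coordinates, compactness, interior *)

Section ConvexHull.
Context {R : realType} {m : nat}.
Local Notation V := 'rV[R]_m.
Implicit Types (A P : set V) (S : {fset V}) (x y : V).

Lemma convex_setP A : @convex_set R V A <->
  forall x y (t : R), A x -> A y -> 0 <= t <= 1 -> A (t *: x + (1 - t) *: y).
Proof.
split=> [cA x y t Ax Ay t01|cA x y l].
  by have := cA x y (Itv01 (andP t01).1 (andP t01).2); rewrite !inE; apply.
rewrite !inE => Ax Ay; apply: cA => //.
by rewrite ge0 le1.
Qed.

Lemma convex_setI_fam (C : set (set V)) :
  (forall A, C A -> @convex_set R V A) ->
  @convex_set R V (\bigcap_(A in C) A).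
Proof.
move=> cC; apply/convex_setP => x y t Cx Cy t01 A CA.
by apply: (convex_setP A).1 => //; [exact: cC|exact: Cx|exact: Cy].
Qed.

Lemma convex_hull_convex A : @convex_set R V (convex_hull A).
Proof. by apply: convex_setI_fam => B []. Qed.

(** Convexity only speaks of two points, so the induction runs over lists with partial sums
    renormalised to total weight one. A tail of weight zero has only zero coefficients and is
    dropped. *)
Lemma convex_set_sum A (I : finType) (q : I -> R) (f : I -> V) :
  @convex_set R V A -> (forall i, A (f i)) -> (forall i, 0 <= q i) ->
  \sum_i q i = 1 -> A (\sum_i q i *: f i).
Proof.
move=> cA Af q0.
suff H (r : seq I) : 0 < \sum_(i <- r) q i ->
    A ((\sum_(i <- r) q i)^-1 *: \sum_(i <- r) q i *: f i).
  by move=> q1; have := H (index_enum I); rewrite q1 invr1 scale1r; apply.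
elim: r => [|i r IH]; rewrite ?big_nil ?ltxx// !big_cons => s0.
have r0 : 0 <= \sum_(j <- r) q j by apply: sumr_ge0.
have [r1|/eqP r1] := eqVneq (\sum_(j <- r) q j) 0.
  have z : \sum_(j <- r) q j *: f j = 0.
    apply: big1_seq => j /= jr; have/eqP := r1.
    rewrite psumr_eq0// => /allP/(_ _ jr) /= /eqP->; exact: scale0r.
  rewrite r1 z !addr0 scalerA mulVf ?scale1r//.
  by apply: lt0r_neq0; rewrite r1 addr0 in s0.
have rp : 0 < \sum_(j <- r) q j by rewrite lt_def r0 andbT; exact/eqP.
set s := _ + _ in s0 *; set r' := \sum_(j <- r) q j in rp *.
have -> : s^-1 *: (q i *: f i + \sum_(j <- r) q j *: f j) =
    (q i / s) *: f i + (1 - q i / s) *: (r'^-1 *: \sum_(j <- r) q j *: f j).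
  rewrite scalerDr !scalerA mulrC; congr (_ + _ *: _).
  rewrite -[1](@divff _ s) ?lt0r_neq0// -mulrBl /s addrAC subrr add0r.
  by rewrite -/r' mulrAC divff ?mul1r// lt0r_neq0.
apply: (convex_setP A).1 => //; first exact: IH.
by rewrite divr_ge0 ?(ltW s0)//= ler_pdivrMr// mul1r /s lerDl.
Qed.

Definition barycentric S x (q : S -> R) : Prop :=
  [/\ forall a, 0 <= q a, \sum_a q a = 1 & \sum_a q a *: val a = x].

Lemma convex_hull_fsetP S x :
  convex_hull [set` S] x <-> exists q : S -> R, barycentric x q.
Proof.
split=> [|[q [q0 q1 <-]]]; last first.
  apply: (convex_set_sum (convex_hull_convex (A := _))) => // a.
  by apply: sub_gen_smallest; exact: valP a.
apply: (@smallest_sub _ _ _ [set x | exists q : S -> R, barycentric x q]).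
  apply/convex_setP => {}x y t [p [p0 p1 <-]] [q [q0 q1 <-]] /andP[t0 t1].
  exists (fun a => t * p a + (1 - t) * q a); split.
  - by move=> a; rewrite addr_ge0// mulr_ge0// subr_ge0.
  - by rewrite big_split/= -!mulr_sumr p1 q1; ring.
  - rewrite !scaler_sumr -big_split/=; apply: eq_bigr => a _.
    by rewrite scalerDl !scalerA.
move=> {}x xS; pose x' : S := FSetSub xS.
exists (fun a => (a == x')%:R); split => [a||]; first by rewrite ler0n.
- by rewrite (bigD1 x')//= eqxx big1 ?addr0// => a /negbTE->.
- rewrite (bigD1 x')//= eqxx scale1r big1 ?addr0// => a /negbTE->.
  by rewrite scale0r.
Qed.

(** The hull is the continuous image of the standard simplex. The simplex is coded by row vectors
    over an enumeration of [S], where it is a closed part of a compact cube. *)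
Lemma convex_hull_compact S : compact (convex_hull [set` S]).
Proof.
pose f (v : 'rV[R]_#|{: S}|) : V := \sum_i v 0 i *: val (enum_val i).
pose K := [set v : 'rV[R]_#|{: S}| | forall i, v 0 i \in `[0, 1]] `&`
          [set v : 'rV[R]_#|{: S}| | \sum_i v 0 i = 1].
have -> : convex_hull [set` S] = f @` K.
  apply/seteqP; split=> [x /convex_hull_fsetP[q [q0 q1 qx]]|_ [v [v01 v1] <-]].
    exists (\row_i q (enum_val i)); [split => /=|].
    - move=> i; rewrite mxE in_itv/= q0/= -q1 (bigD1 (enum_val i))//= lerDl.
      exact: sumr_ge0.
    - under eq_bigr do rewrite mxE.
      by rewrite -q1 (big_enum_val (A := {: S}) q); apply: eq_bigl => a.
    - rewrite /f -qx; under eq_bigr do rewrite mxE.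
      rewrite -(big_enum_val (A := {: S}) (fun a => q a *: val a)).
      by apply: eq_bigl.
  apply/convex_hull_fsetP; exists (fun a => v 0 (enum_rank a)); split.
  - by move=> a; have := v01 (enum_rank a); rewrite in_itv/= => /andP[].
  - rewrite -v1 (reindex_onto enum_rank enum_val)/=; last first.
      by move=> i _; exact: enum_valK.
    by apply: eq_bigl => a; rewrite enum_rankK eqxx.
  - rewrite /f [RHS](reindex_onto enum_rank enum_val)/=; last first.
      by move=> i _; exact: enum_valK.
    by apply: eq_big => [a|a _]; rewrite enum_rankK ?eqxx.
apply: continuous_compact.
  apply: continuous_subspaceT => v.
  apply: (@cvg_finsum _ _ _ (nbhs v)) => i.
  by apply: cvgZr_tmp; exact: coord_continuous.
apply: compact_closedI.
  apply: (@rV_compact R _ (fun=> `[0, 1]%classic)) => i; exact: segment_compact.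
apply: (@closed_comp _ _ (fun v : 'rV[R]_#|{: S}| => \sum_i v 0 i) [set 1]).
  move=> v _; apply: (@cvg_finsum _ _ _ (nbhs v)) => i.
  exact: coord_continuous.
exact: closed_eq.
Qed.

Lemma convex_hull_closed S : closed (convex_hull [set` S]).
Proof. by apply: compact_closed; [exact: norm_hausdorff|exact: convex_hull_compact]. Qed.

(** The homothety of center [y] and ratio [t] sends a ball of radius [e] around [x] to a ball of
    radius [t * e] around the new point, and keeps it in [P]. *)
Lemma interior_convexl P x y (t : R) : @convex_set R V P ->
  P° x -> P y -> 0 < t <= 1 -> P° (t *: x + (1 - t) *: y).
Proof.
move=> cP Px Py /andP[t0 t1].
have /nbhs_ballP[e /= e0 eP] : nbhs x P by exact: Px.
apply/nbhs_ballP; exists (t * e) => /=; first by rewrite mulr_gt0.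
move=> z; rewrite -ball_normE /= => zt.
have -> : z = t *: (t^-1 *: (z - (1 - t) *: y)) + (1 - t) *: y.
  by rewrite scalerA divff ?lt0r_neq0// scale1r subrK.
apply: (convex_setP P).1 => //; last by rewrite ltW.
apply: eP; rewrite -ball_normE /=.
have -> : x - t^-1 *: (z - (1 - t) *: y) = t^-1 *: (t *: x + (1 - t) *: y - z).
  rewrite -[x in LHS](scale1r) -(mulVf (lt0r_neq0 t0)) -scalerA -scalerBr.
  by rewrite opprB addrA.
by rewrite normrZ gtr0_norm ?invr_gt0// ltr_pdivrMl.
Qed.

Lemma interior_convex_dense P x : @convex_set R V P -> P° !=set0 -> P x ->
  closure P° x.
Proof.
move=> cP [x0 Px0] Px A /nbhs_ballP[e /= e0 eA].
(* This ratio is at most 1, and going the fraction [t] of the way from [x] to [x0] moves [x] by less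
   than [e]. *)
pose t := e / (e + `|x0 - x| + `|x0 - x|).
have n0 : 0 <= `|x0 - x| by [].
have d0 : 0 < e + `|x0 - x| + `|x0 - x| by lra.
have t0 : 0 < t by rewrite divr_gt0.
have t1 : t <= 1 by rewrite ler_pdivrMr//; lra.
exists (t *: x0 + (1 - t) *: x); split; first by apply: interior_convexl; rewrite ?t0.
apply: eA; rewrite -ball_normE /=.
have -> : x - (t *: x0 + (1 - t) *: x) = - (t *: (x0 - x)).
  by apply/rowP => i; rewrite !mxE; ring.
rewrite normrN normrZ gtr0_norm// /t mulrAC ltr_pdivrMr// ltr_pM2l//; lra.
Qed.

(** The norm is the sup norm, so a move of length [e / 2] along one coordinate where [|t|] is
    attained, with the sign of that coordinate, gives a point of the hull where the form equals
    [e / 2 * |t|]. That value is a mean of the values at the points of [S], hence one of them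
    reaches it. This bound gives coercivity of the exponential sum and continuity of the inverse
    map. *)
Lemma interior_support S x : (convex_hull [set` S])° x ->
  exists2 r : R, 0 < r & forall t : V, exists a : S, r * `|t| <= dotp (val a - x) t.
Proof.
move=> Px; have /nbhs_ballP[e /= e0 eP] : nbhs x (convex_hull [set` S]) by exact: Px.
exists (e / 2) => [|t]; first by rewrite divr_gt0.
have [z Pz zt] : exists2 z, convex_hull [set` S] z & dotp (z - x) t = e / 2 * `|t|.
  have [t0|t0] := eqVneq `|t| 0.
    exists x; first exact: interior_subset.
    by rewrite subrr dotp0l t0 mulr0.
  have [[i0 i] /= ti] := mx_norm_neq0 t0.
  rewrite ord1 in ti.
  pose s := Num.sg (t 0 i).
  exists (x + (e / 2 * s) *: delta_mx 0 i).
    apply: eP; rewrite -ball_normE /= opprD addrA subrr sub0r normrN normrZ.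
    have -> : `|delta_mx 0 i : V| = 1.
      rewrite [LHS]mx_normrE; apply/le_anti/andP; split.
        apply/bigmax_leP; split => // -[k l] _ /=.
        by rewrite mxE; case: (_ && _); rewrite ?normr1 ?normr0.
      by apply/bigmax_geP; right; exists (0, i) => //=; rewrite mxE !eqxx normr1.
    rewrite mulr1 normrM gtr0_norm ?divr_gt0//.
    rewrite (@le_lt_trans _ _ (e / 2))//; last lra.
    by rewrite ler_piMr ?divr_ge0 ?(ltW e0)// normr_sg; case: (_ != 0).
  have -> : `|t| = `|t 0 i| by exact: ti.
  by rewrite addrC addKr dotpZl dotpC dotp_delta normrEsg mulrA.
have /convex_hull_fsetP[q [q0 q1 qz]] := Pz.
apply: contrapT => /forallNP H.
have : e / 2 * `|t| < e / 2 * `|t|; last by rewrite ltxx.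
rewrite -{1}zt -qz.
have -> : dotp (\sum_a q a *: val a - x) t = \sum_a q a * dotp (val a - x) t.
  rewrite -[x in LHS]scale1r -q1 scaler_suml -sumrB dotp_suml.
  by apply: eq_bigr => a _; rewrite -scalerBr dotpZl.
have [a qa] : exists a, 0 < q a.
  apply: contrapT => /forallNP qN; have := q1.
  rewrite big1 => [/eqP|a _]; first by rewrite eq_sym oner_eq0.
  by apply/le_anti; rewrite q0 andbT leNgt; apply/negP/qN.
have kE : e / 2 * `|t| = \sum_a q a * (e / 2 * `|t|) by rewrite -mulr_suml q1 mul1r.
rewrite [ltRHS]kE [ltLHS](bigD1 a)//= [ltRHS](bigD1 a)//=.
apply: ltr_leD; first by rewrite ltr_pM2l// ltNge; apply/negP/H.
by apply: ler_sum => b _; rewrite ler_wpM2l// ltW// ltNge; apply/negP/H.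
Qed.

(** A form constant on [S] takes the same value at an interior point [x], so the bound of
    [interior_support] reads [r * |v| <= 0]. *)
Lemma dotp_cst_eq0 S (v : V) (k : R) : (convex_hull [set` S])° !=set0 ->
  (forall a : S, dotp (val a) v = k) -> v = 0.
Proof.
move=> [x Px] vk; have [r r0 /(_ v)[a]] := interior_support Px.
have /convex_hull_fsetP[q [_ q1 <-]] := interior_subset Px.
rewrite dotpBl vk dotp_suml (eq_bigr (fun a => q a * k)); last first.
  by move=> b _; rewrite dotpZl vk.
rewrite -mulr_suml q1 mul1r subrr pmulr_rle0// normr_le0 => /eqP; exact.
Qed.

Lemma convex_hull_interior_sub S (P : set V) : @convex_set R V P -> P° !=set0 ->
  [set` S] `<=` P -> P° `<=` convex_hull [set` S] -> convex_hull [set` S] = P.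
Proof.
move=> cP P0 SP PS; apply/seteqP; split; first exact: smallest_sub.
move=> x /(interior_convex_dense cP P0) clx.
by apply: (convex_hull_closed (S := S)) => A /clx [y [/PS Sy Ay]]; exists y.
Qed.

End ConvexHull.

(** * Differentiability in epsilon form *)

Section Differential.
Context {R : realType} {V W : normedModType R}.
Implicit Types (f g : V -> W) (x : V).

(** The little-o is unfolded and recentred at [x]; with the converse below, it allows derivatives to
    be handled by plain inequalities. *)
Lemma differentiable_expansion f x : differentiable f x ->
  forall e, 0 < e ->
  \forall y \near x, `|f y - f x - 'd f x (y - x)| <= e * `|y - x|.
Proof.
move=> /diff_locallyP[_ /eqaddoP H] e /H; rewrite !near_simpl => He.
rewrite (near_shift 0 x); near=> y; rewrite /= subr0.
have -> : f (y + x) - f x - 'd f x (y + x - x) =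
    (f \o shift x - (cst (f x) + 'd f x)) y.
  by rewrite addrK /= opprD addrA.
by rewrite addrK; near: y.
Unshelve. all: by end_near. Qed.

Lemma differentiable_of_expansion f x (L : {linear V -> W}) : continuous L ->
  (forall e, 0 < e ->
    \forall y \near x, `|f y - f x - L (y - x)| <= e * `|y - x|) ->
  differentiable f x /\ 'd f x = L :> (V -> W).
Proof.
move=> cL fL.
have o : f \o shift x = cst (f x) + L +o_ (0 : V) id.
  apply/eqaddoP => e /fL; rewrite (near_shift 0 x) !near_simpl => H.
  near=> y.
  have -> : (f \o shift x - (cst (f x) + L)) y = f (y + x) - f x - L (y + x - x).
    by rewrite addrK /= opprD addrA.
  rewrite -[X in _ <= _ * `|X|](addrK x y); near: y.
  by apply: filterS H => y /=; rewrite subr0.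
have dE := diff_unique cL o.
split=> //; apply/diff_locallyP; rewrite dE; split=> //.
Unshelve. all: by end_near. Qed.

Lemma near_eq_differentiable f g x : (\forall y \near x, f y = g y) ->
  differentiable f x -> differentiable g x.
Proof.
move=> fg df.
suff [] : differentiable g x /\ 'd g x = 'd f x :> (V -> W) by [].
apply: differentiable_of_expansion; first exact: diff_continuous.
move=> e e0; have fgx := nbhs_singleton fg.
apply: filter_app (differentiable_expansion df e0).
by apply: filter_app fg; near=> y => fgy; rewrite -fgy -fgx.
Unshelve. all: by end_near. Qed.

End Differential.

(** * Derivative of a continuous local right inverse *)

Section InverseFunction.
Context {R : realType} {m : nat}.
Local Notation V := 'rV[R]_m.

Lemma mulmxr_continuous (A : 'M[R]_m) : continuous (mulmxr A : V -> V).
Proof.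
move=> v; apply: differentiable_continuous.
have -> : (mulmxr A : V -> V) = (fun v => \sum_i v 0 i *: row i A).
  by apply/funext => u /=; rewrite mulmx_sum_row.
have -> : (fun v : V => \sum_i v 0 i *: row i A) =
    \sum_i (fun v : V => v 0 i *: row i A).
  by apply/funext => u; rewrite fct_sumE.
apply: differentiable_sum => i; apply: differentiableZl.
exact: differentiable_coord.
Qed.

(** With [g] continuous at [x], the expansion of [f] at [g x] can be evaluated at [g y] and solved
    for the increment [h = g y - g x]: it gives [y - x = h *m A + r] with [|r| <= d * |h|]. *)
Lemma differentiable_inverse (f g : V -> V) (x : V) (A : 'M[R]_m) :
  differentiable f (g x) -> 'd f (g x) = mulmxr A :> (V -> V) ->
  A \in unitmx -> {for x, continuous g} -> (\forall y \near x, f (g y) = y) ->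
  differentiable g x /\ 'd g x = mulmxr (invmx A) :> (V -> V).
Proof.
move=> df dfE Au cg fg; have fgx := nbhs_singleton fg.
apply: differentiable_of_expansion; first exact: mulmxr_continuous.
have [M M0 HM] := linear_lipschitz (f := mulmxr (invmx A) : {linear V -> V})
  (@mulmxr_continuous (invmx A)).
move=> e e0.
pose N := M + 1; have N0 : 0 < N by rewrite /N; lra.
have bound (v : V) : `|v *m invmx A| <= N * `|v|.
  by apply: (le_trans (HM v)); rewrite ler_wpM2r// /N; lra.
(* The first bound lets [N * |r|] be absorbed in half of [|h|], whence [|h| <= 2 * N * |y - x|]; the
   second then brings the error [N * d * |h|] below [e * |y - x|]. *)
pose d := Num.min (2 * N)^-1 (e / (2 * N * N)).
have d0 : 0 < d by rewrite lt_min !(invr_gt0, divr_gt0, mulr_gt0).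
have := cg _ (differentiable_expansion df d0); rewrite !near_simpl /= => H.
near=> y.
have fgy : f (g y) = y by near: y.
have : `|f (g y) - f (g x) - 'd f (g x) (g y - g x)| <= d * `|g y - g x|.
  by near: y.
rewrite dfE fgy fgx /=; set h := g y - g x; set r := y - x - h *m A => rh.
have hE : h = (y - x) *m invmx A - r *m invmx A.
  by rewrite -mulmxBl /r subKr mulmxK.
have -> : h - (y - x) *m invmx A = - (r *m invmx A).
  by rewrite {1}hE addrAC subrr add0r.
rewrite normrN; have br := bound r; have bx := bound (y - x).
have dN1 : d * N <= 2^-1.
  apply: (@le_trans _ _ ((2 * N)^-1 * N)).
    by rewrite ler_wpM2r ?(ltW N0)// ge_min lexx.
  by rewrite invfM mulfVK// lt0r_neq0.
have dN2 : d * (2 * N * N) <= e.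
  apply: (@le_trans _ _ (e / (2 * N * N) * (2 * N * N))).
    by rewrite ler_wpM2r ?mulr_ge0 ?(ltW N0)// ge_min lexx orbT.
  by rewrite divfK// lt0r_neq0// !mulr_gt0.
have hb : `|h| <= 2 * N * `|y - x|.
  have : `|h| <= N * `|y - x| + N * `|r|.
    by rewrite {1}hE (le_trans (ler_normB _ _))// lerD.
  have : N * `|r| <= 2^-1 * `|h|.
    apply: (@le_trans _ _ (N * (d * `|h|))); first by rewrite ler_wpM2l// ltW.
    by rewrite mulrA (mulrC N) ler_wpM2r.
  lra.
apply: (le_trans br); apply: (@le_trans _ _ (N * (d * (2 * N * `|y - x|)))).
  rewrite ler_wpM2l ?(ltW N0)//; apply: (le_trans rh).
  by rewrite ler_wpM2l// (ltW d0).
have -> : N * (d * (2 * N * `|y - x|)) = d * (2 * N * N) * `|y - x| by ring.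
by rewrite ler_wpM2r.
Unshelve. all: by end_near. Qed.

End InverseFunction.

(** * Stability of the classes [Ck_on] under algebraic operations *)

Section Smoothness.
Context {R : realType} {m : nat}.
Local Notation V := 'rV[R]_m.
Variable U : set V.
Hypothesis oU : open U.

Lemma Ck_onW (W : normedModType R) k (f : V -> W) : Ck_on U k.+1 f -> Ck_on U k f.
Proof.
elim: k f => [f [df _] x Ux|k IH f [df Df]].
  exact: differentiable_continuous (df x Ux).
by split=> // v; apply: IH; exact: Df.
Qed.

(** As [U] is open, agreement on [U] is agreement near each of its points, so it passes to
    derivatives. This allows a function to be replaced by a formula valid on [U] only. *)
Lemma eq_Ck_on (W : normedModType R) k (f g : V -> W) :
  (forall x, U x -> f x = g x) -> Ck_on U k f -> Ck_on U k g.
Proof.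
elim: k f g => [|k IH] f g fg.
  move=> cf x Ux; rewrite /prop_for /continuous_at -fg//.
  apply: cvg_trans (cf x Ux); apply: (@near_eq_cvg _ _ (nbhs x)).
  by near=> y; apply: fg; near: y; exact: open_nbhs_nbhs.
have near_fg x : U x -> \forall y \near x, f y = g y.
  move=> Ux; near=> y; apply: fg; near: y; exact: open_nbhs_nbhs.
move=> [df Df]; split=> [x Ux|v].
  by apply: near_eq_differentiable (df x Ux); exact: near_fg.
apply: IH (Df v) => x Ux; have [->|v0] := eqVneq v 0; first by rewrite !derive0.
by apply: near_eq_derive => //; exact: near_fg.
Unshelve. all: by end_near. Qed.

Lemma Ck_on_cst (W : normedModType R) k (w : W) : Ck_on U k (fun _ : V => w).
Proof.
elim: k w => [|k IH] w; first by move=> x _; exact: cst_continuous.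
split=> [x _|v]; first exact: differentiable_cst.
by apply: eq_Ck_on (IH 0) => x _; rewrite derive_cst.
Qed.

Lemma Ck_onD (W : normedModType R) k (f g : V -> W) :
  Ck_on U k f -> Ck_on U k g -> Ck_on U k (fun x => f x + g x).
Proof.
elim: k f g => [|k IH] f g.
  by move=> cf cg x Ux; exact: cvgD (cf x Ux) (cg x Ux).
move=> [df Df] [dg Dg]; split=> [x Ux|v].
  by apply: differentiableD; [exact: df|exact: dg].
apply: eq_Ck_on (IH _ _ (Df v) (Dg v)) => x Ux.
by rewrite -deriveD//; apply: diff_derivable; [exact: df|exact: dg].
Qed.

Lemma Ck_onM k (f g : V -> R) :
  Ck_on U k f -> Ck_on U k g -> Ck_on U k (fun x => f x * g x).
Proof.
elim: k f g => [|k IH] f g.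
  by move=> cf cg x Ux; exact: cvgM (cf x Ux) (cg x Ux).
move=> Ckf Ckg; have [df Df] := Ckf; have [dg Dg] := Ckg.
split=> [x Ux|v].
  by apply: differentiableM; [exact: df|exact: dg].
have H := Ck_onD (IH _ _ (Ck_onW Ckf) (Dg v)) (IH _ _ (Ck_onW Ckg) (Df v)).
apply: eq_Ck_on H => x Ux.
by rewrite -deriveM//; apply: diff_derivable; [exact: df|exact: dg].
Qed.

Lemma Ck_onV k (f : V -> R) : (forall x, U x -> f x != 0) ->
  Ck_on U k f -> Ck_on U k (fun x => (f x)^-1).
Proof.
move=> f0; elim: k => [|k IH].
  by move=> cf x Ux; exact: cvgV (f0 x Ux) (cf x Ux).
move=> Ckf; have [df Df] := Ckf; split=> [x Ux|v].
  by apply: differentiableV; [exact: df|exact: f0].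
have CV := IH (Ck_onW Ckf).
have H := Ck_onM (Ck_on_cst k (-1 : R)) (Ck_onM (Ck_onM CV CV) (Df v)).
apply: eq_Ck_on H => x Ux.
rewrite deriveV ?f0//; last by apply: diff_derivable; exact: df.
by rewrite /= -[RHS]/(- (f x) ^- 2 * 'D_v f x) mulN1r -mulNr expr2 invfM.
Qed.

Lemma Ck_onZl (W : normedModType R) k (f : V -> R) (w : W) :
  Ck_on U k f -> Ck_on U k (fun x => f x *: w).
Proof.
elim: k f => [|k IH] f.
  by move=> cf x Ux; exact: cvgZr_tmp (cf x Ux).
move=> [df Df]; split=> [x Ux|v].
  by apply: differentiableZl; exact: df.
apply: eq_Ck_on (IH _ (Df v)) => x Ux.
rewrite !deriveE; [|by apply: differentiableZl; exact: df|exact: df].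
by rewrite diffZl//; exact: df.
Qed.

Lemma Ck_on_sum (W : normedModType R) k (I : finType) (f : I -> V -> W) :
  (forall i, Ck_on U k (f i)) -> Ck_on U k (fun x => \sum_i f i x).
Proof.
move=> Cf; suff H (r : seq I) : Ck_on U k (fun x => \sum_(i <- r) f i x) by exact: H.
elim: r => [|i r IH].
  by apply: eq_Ck_on (Ck_on_cst k (0 : W)) => x _; rewrite big_nil.
by apply: eq_Ck_on (Ck_onD (Cf i) IH) => x _; rewrite big_cons.
Qed.

Lemma Ck_on_prod k (I : finType) (f : I -> V -> R) :
  (forall i, Ck_on U k (f i)) -> Ck_on U k (fun x => \prod_i f i x).
Proof.
move=> Cf; suff H (r : seq I) : Ck_on U k (fun x => \prod_(i <- r) f i x) by exact: H.
elim: r => [|i r IH].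
  by apply: eq_Ck_on (Ck_on_cst k (1 : R)) => x _; rewrite big_nil.
by apply: eq_Ck_on (Ck_onM (Cf i) IH) => x _; rewrite big_cons.
Qed.

Lemma derive_coord (x v : V) i : 'D_v (fun y : V => y 0 i) x = v 0 i.
Proof.
have d : derivable (@id V) x v by exact: derivable_id.
by have := derive_mx d; rewrite derive_id => /rowP/(_ i); rewrite mxE => <-.
Qed.

Lemma Ck_on_coord k i : Ck_on U k (fun x : V => x 0 i).
Proof.
case: k => [|k]; first by move=> x _; exact: coord_continuous.
split=> [x _|v]; first exact: differentiable_coord.
by apply: eq_Ck_on (Ck_on_cst k (v 0 i)) => x _; rewrite derive_coord.
Qed.

Lemma Ck_on_det k n (A : V -> 'M[R]_n) :
  (forall i j, Ck_on U k (fun x => A x i j)) -> Ck_on U k (fun x => \det (A x)).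
Proof.
move=> CA; apply: Ck_on_sum => s; apply: Ck_onM; first exact: Ck_on_cst.
by apply: Ck_on_prod => i; exact: CA.
Qed.

(** Cramer's rule: the entries of the inverse are cofactors divided by a determinant that does not
    vanish on [U]. *)
Lemma Ck_on_invmx k n (A : V -> 'M[R]_n) : (forall x, U x -> A x \in unitmx) ->
  (forall i j, Ck_on U k (fun x => A x i j)) ->
  forall i j, Ck_on U k (fun x => invmx (A x) i j).
Proof.
move=> Au CA i j.
have Cadj : Ck_on U k (fun x => (\adj (A x)) i j).
  apply: (eq_Ck_on (f := fun x => (-1) ^+ (j + i) *
      \det (row' j (col' i (A x))))) => [x _|]; first by rewrite mxE /cofactor.
  apply: Ck_onM; first exact: Ck_on_cst.
  apply: Ck_on_det => p q; apply: eq_Ck_on (CA (lift j p) (lift i q)) => x _.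
  by rewrite !mxE.
have CV : Ck_on U k (fun x => (\det (A x))^-1).
  apply: Ck_onV (Ck_on_det CA) => x Ux.
  by have := Au x Ux; rewrite unitmxE unitfE.
apply: eq_Ck_on (Ck_onM CV Cadj) => x Ux.
by rewrite /invmx Au// !mxE.
Qed.

Lemma Ck_on_mx k n p (A : V -> 'M[R]_(n, p)) :
  (forall i j, Ck_on U k (fun x => A x i j)) -> Ck_on U k A.
Proof.
move=> CA; apply: (eq_Ck_on (f := fun x => \sum_i \sum_j A x i j *: delta_mx i j)).
  by move=> x _; rewrite -matrix_sum_delta.
by apply: Ck_on_sum => i; apply: Ck_on_sum => j; apply: Ck_onZl.
Qed.

End Smoothness.

(** * Limits along filters and ultrafilters *)

Section LimitBounds.
Context {R : realType} {T : Type} (F : set_system T) {PF : ProperFilter F}.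
Implicit Types (f : T -> R) (k l : R).

Lemma cvg_ge_lim f k l : f @ F --> l -> (\forall x \near F, k <= f x) -> k <= l.
Proof.
move=> fl kf; rewrite -(cvg_lim (@norm_hausdorff _ R) fl).
by apply: limr_ge => //; exact: cvgP fl.
Qed.

Lemma cvg_le_lim f k l : f @ F --> l -> (\forall x \near F, f x <= k) -> l <= k.
Proof.
move=> fl kf; rewrite -(cvg_lim (@norm_hausdorff _ R) fl).
by apply: limr_le => //; exact: cvgP fl.
Qed.

End LimitBounds.

(** Compactness gives a cluster point of the image filter; for an ultrafilter a cluster point is a
    limit, since each preimage or its complement belongs to it. *)
Lemma ultra_image_cvg {T : Type} {X : topologicalType} (G : set_system T)
    (f : T -> X) (K : set X) : UltraFilter G -> compact K -> G (f @^-1` K) ->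
  exists2 p, K p & f @ G --> p.
Proof.
move=> UG cK GK; have PG : ProperFilter G by exact: ultra_proper.
have [p [Kp clp]] := cK (f @ G) _ GK.
exists p => // N Np; have [//|GN] := in_ultra_setVsetC (f @^-1` N) UG.
by have [q [/= Nq1 Nq2]] := clp (~` N) N GN Np.
Qed.

(** If the preimage of a neighborhood [N] of [p] is not in [F], the trace of [F] on its complement
    is proper, and an ultrafilter refining that trace contradicts the hypothesis. *)
Lemma cvg_ultraP {T : Type} {X : topologicalType} (F : set_system T)
    (f : T -> X) (p : X) : ProperFilter F ->
  (forall G, UltraFilter G -> F `<=` G -> f @ G --> p) -> f @ F --> p.
Proof.
move=> PF fp N Np; apply: contrapT => FN.
have PF' : ProperFilter (within (~` (f @^-1` N)) F).
  apply: Build_ProperFilter_ex => A FA; apply: contrapT => A0; apply: FN.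
  rewrite /within /= in FA.
  apply: (@filterS _ F _ _ _ _ FA) => x /= xA; apply: contrapT => Nx.
  by apply: A0; exists x; exact: xA.
have [G [UG FG]] := ultraFilterLemma PF'.
have PG : ProperFilter G by exact: ultra_proper.
have FG' : F `<=` G by move=> A FA; apply: FG; exact: (@filterS _ F _ A _ _ FA).
have GN : G (f @^-1` N) by exact: fp.
have GNc : G (~` (f @^-1` N)).
  by apply: FG; rewrite /within /=; apply: (@filterE _ F).
by have [x [/= ? ?]] := filter_ex (filterI GN GNc).
Qed.

(** Both values are limits along the trace of the neighborhoods of [x] on [P°], which is a proper
    filter because [x] is adherent to [P°]. *)
Lemma eq_within_interior {R : realType} {V W : normedModType R} (P : set V)
    (f g : V -> W) (x : V) : closure P° x -> P x ->
  {within P, continuous f} -> {within P, continuous g} ->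
  (forall y, P° y -> f y = g y) -> f x = g x.
Proof.
move=> clx Px /subspace_continuousP/(_ x Px) fx /subspace_continuousP/(_ x Px) gx fg.
have PF : ProperFilter (within P° (nbhs x)) by exact: within_nbhs_proper.
have sub : within P° (nbhs x) `=>` within P (nbhs x).
  move=> A; apply: (@filterS _ (nbhs x)) => y Ay /interior_subset; exact: Ay.
apply: (@cvg_unique W (@norm_hausdorff _ W) (f @ within P° (nbhs x))).
  exact: cvg_trans (cvg_app f sub) fx.
apply: cvg_trans _ (cvg_trans (cvg_app g sub) gx); apply: near_eq_cvg.
by apply: (@filterE _ (nbhs x)) => y /fg->.
Qed.

(** * Derivatives of finite sums and of exponentials *)

Section Derivatives.
Context {R : realType} {V W : normedModType R}.

Lemma is_derive_finsum (I : finType) (h : I -> V -> W) (dh : I -> W) (x v : V) :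
  (forall i, is_derive x v (h i) (dh i)) ->
  is_derive x v (fun y => \sum_i h i y) (\sum_i dh i).
Proof.
move=> H; suff G (r : seq I) :
    is_derive x v (fun y => \sum_(i <- r) h i y) (\sum_(i <- r) dh i) by exact: G.
elim: r => [|i r IH].
  have -> : (fun y => \sum_(i <- [::]) h i y) = cst 0.
    by apply/funext => y; rewrite big_nil.
  by rewrite big_nil; exact: is_derive_cst.
have -> : (fun y => \sum_(j <- i :: r) h j y) =
    (h i + fun y => \sum_(j <- r) h j y).
  by apply/funext => y; rewrite big_cons.
by rewrite big_cons; exact: is_deriveD.
Qed.

Lemma differentiable_finsum (I : finType) (h : I -> V -> W) (x : V) :
  (forall i, differentiable (h i) x) ->
  differentiable (fun y => \sum_i h i y) x.
Proof.
move=> H; suff G (r : seq I) : differentiable (fun y => \sum_(i <- r) h i y) x.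
  exact: G.
elim: r => [|i r IH].
  have -> : (fun y => \sum_(i <- [::]) h i y) = cst 0.
    by apply/funext => y; rewrite big_nil.
  exact: differentiable_cst.
have -> : (fun y => \sum_(j <- i :: r) h j y) =
    (h i + fun y => \sum_(j <- r) h j y).
  by apply/funext => y; rewrite big_cons.
exact: differentiableD.
Qed.

Lemma differentiable_expR_comp (f : V -> R) (x : V) :
  differentiable f x -> differentiable (fun y => expR (f y)) x.
Proof.
by move=> df; apply: (@differentiable_comp _ _ _ _ f expR) => //;
  apply/derivable1_diffP.
Qed.

Lemma derive_expR_comp (f : V -> R) (x v : V) :
  differentiable f x -> 'D_v (fun y => expR (f y)) x = expR (f x) * 'D_v f x.
Proof.
move=> df; have de : differentiable (@expR R) (f x) by exact/derivable1_diffP.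
rewrite deriveE; last exact: differentiable_expR_comp.
rewrite (@diff_comp _ _ _ _ f expR)// /= deriv1E; last exact: derivable_expR.
by rewrite derive1E derive_val deriveE// mulrC.
Qed.

Lemma is_derive_expR_comp (f : V -> R) (x v : V) (d : R) :
  differentiable f x -> 'D_v f x = d ->
  is_derive x v (fun y => expR (f y)) (expR (f x) * d).
Proof.
move=> df <-; apply: DeriveDef; last exact: derive_expR_comp.
exact/diff_derivable/differentiable_expR_comp.
Qed.

End Derivatives.

(** The equality case is kept so that a vanishing sum of such terms forces equality term by term. *)
Lemma ln_monotone_le0 {R : realType} (p q : R) : 0 < p -> 0 < q ->
  (q - p) * (ln p - ln q) <= 0 ?= iff (p == q).
Proof.
move=> p0 q0; have [pq|pq|->] := ltgtP p q; last 1 first.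
- by rewrite !subrr mul0r; split => //; rewrite eqxx.
- have H : (q - p) * (ln p - ln q) < 0.
    by rewrite pmulr_rlt0 ?subr_gt0// subr_lt0 ltr_ln ?posrE.
  by split; [exact: ltW|rewrite lt_eqF].
- have H : (q - p) * (ln p - ln q) < 0.
    by rewrite nmulr_rlt0 ?subr_lt0// subr_gt0 ltr_ln ?posrE.
  by split; [exact: ltW|rewrite lt_eqF].
Qed.

(** * Gibbs weights and bijectivity of [mu_Sc] onto the interior *)

Section Toric.
Context {R : realType} {m : nat}.
Local Notation V := 'rV[R]_m.
Variables (S : {fset V}) (c : S -> R).
Local Notation P := (convex_hull [set` S]).
Hypothesis P0 : P° !=set0.
Hypothesis c0 : forall a, 0 < c a.

Let Z (t : V) : R := \sum_(b : S) c b * expR (dotp (val b) t).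

Lemma exp_weight_gt0 t a : 0 < c a * expR (dotp (val a) t).
Proof. by rewrite mulr_gt0 ?expR_gt0. Qed.

Lemma hull_nonempty : exists a0 : S, true.
Proof. by have [x /interior_support[r _ /(_ 0)[a _]]] := P0; exists a. Qed.

Lemma partition_gt0 t : 0 < Z t.
Proof.
have [a _] := hull_nonempty; rewrite /Z (bigD1 a)//= ltr_wpDr ?exp_weight_gt0//.
by apply: sumr_ge0 => b _; exact/ltW/exp_weight_gt0.
Qed.

Lemma weight_gt0 t a : 0 < weight c t a.
Proof. by rewrite divr_gt0 ?exp_weight_gt0// partition_gt0. Qed.

Lemma weight_barycentric t : barycentric (mu_Sc c t) (weight c t).
Proof.
split=> // [a|]; first exact/ltW/weight_gt0.
by rewrite -mulr_suml divff// lt0r_neq0// partition_gt0.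
Qed.

Lemma ln_weight t a :
  ln (weight c t a) - ln (c a) = dotp (val a) t - ln (Z t).
Proof.
rewrite ln_div ?posrE ?exp_weight_gt0 ?partition_gt0//.
by rewrite lnM ?posrE ?expR_gt0// expRK /Z; ring.
Qed.

(* [ln (weight / c)] is an affine function of the point of [S], so its mean only
   depends on the barycenter. *)
Lemma mean_ln_weight t x (p q : S -> R) : barycentric x p -> barycentric x q ->
  \sum_a (q a - p a) * (ln (weight c t a) - ln (c a)) = 0.
Proof.
move=> [_ p1 px] [_ q1 qx].
have H (r : S -> R) : \sum_a r a = 1 -> \sum_a r a *: val a = x ->
    \sum_a r a * (ln (weight c t a) - ln (c a)) = dotp x t - ln (Z t).
  move=> r1 rx; rewrite -rx dotp_suml -[ln (Z t)]mul1r -r1 mulr_suml -sumrB.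
  by apply: eq_bigr => a _; rewrite ln_weight dotpZl mulrBr.
by under eq_bigr do rewrite mulrBl; rewrite sumrB !H// subrr.
Qed.

Lemma weight_inj s t : weight c s =1 weight c t -> s = t.
Proof.
move=> w; apply/eqP; rewrite -subr_eq0; apply/eqP.
apply: (dotp_cst_eq0 (k := ln (Z s) - ln (Z t)) P0) => a; rewrite dotpBr.
by have := ln_weight s a; have := ln_weight t a; rewrite w; lra.
Qed.

(** The weights at [s] and [t] are barycentric coordinates of the same point. Subtracting the mean
    identities for [s] and for [t] cancels [ln (c a)] and leaves a zero sum of nonpositive terms. *)
Lemma mu_Sc_inj : injective (mu_Sc c).
Proof.
move=> s t st; apply: weight_inj => a.
have bs := weight_barycentric s; have bt := weight_barycentric t.
rewrite -st in bt.
have h1 := mean_ln_weight s bs bt; have h2 := mean_ln_weight t bs bt.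
have : \sum_a (weight c t a - weight c s a) *
    (ln (weight c s a) - ln (weight c t a)) == 0.
  have := f_equal2 (fun u v => u - v) h1 h2; rewrite subrr -sumrB => h.
  by apply/eqP; rewrite -[RHS]h; apply: eq_bigr => b _; ring.
rewrite -oppr_eq0 -sumrN psumr_eq0 => [/allP/(_ a)|b _]; last first.
  by rewrite oppr_ge0 (ln_monotone_le0 (weight_gt0 s b) (weight_gt0 t b)).
rewrite mem_index_enum oppr_eq0 => /(_ isT) /=.
by rewrite (ln_monotone_le0 (weight_gt0 s a) (weight_gt0 t a)) => /eqP.
Qed.

(** The gradient is tested against each direction [v]: the sum restricted to the line [t + s *: v]
    has a minimum at [s = 0]. *)
Lemma exp_sum_critical (x t : V) :
  (forall s, \sum_a c a * expR (dotp (val a - x) t) <=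
             \sum_a c a * expR (dotp (val a - x) s)) ->
  \sum_a (c a * expR (dotp (val a - x) t)) *: (val a - x) = 0.
Proof.
move=> tmin; apply: dotp_eq0 => v.
pose w a := c a * expR (dotp (val a - x) t); pose d (a : S) := dotp (val a - x) v.
pose phi (s : R) := \sum_a w a * expR (s * d a).
have dphi (s : R) : is_derive s 1 phi (\sum_a w a * (expR (s * d a) * d a)).
  apply: is_derive_finsum => a.
  have H : is_derive s 1 (fun s => expR (s * d a)) (expR (s * d a) * d a).
    apply: (@is_derive1_comp _ expR (fun s => s * d a)).
    rewrite -[X in is_derive _ _ _ X]mulr1.
    have -> : ( *%R^~ (d a)) = (d a) *: (@id R).
      by apply/funext => u; rewrite /= mulrC.
    exact: is_deriveZ.
  have := is_deriveZ (w a) H; exact.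
have phi0 : is_derive (0 : R) 1 phi 0.
  apply: (@derive1_at_min _ phi (-1) 1); rewrite ?in_itv/=; [lra|by move=> s _|lra|].
  move=> s _; rewrite /phi; under eq_bigr do rewrite mul0r expR0 mulr1.
  apply: (le_trans (tmin (t + s *: v))); apply: ler_sum => a _.
  by rewrite dotpDr dotpZr expRD mulrA.
have := @derive_val _ _ _ _ _ _ _ (dphi 0).
rewrite (@derive_val _ _ _ _ _ _ _ phi0) dotp_suml => H; rewrite [RHS]H.
by apply: eq_bigr => a _; rewrite dotpZl mul0r expR0 mul1r.
Qed.

Lemma mu_Sc_surj x : P° x -> exists t, mu_Sc c t = x.
Proof.
move=> Px; have [r r0 supp] := interior_support Px.
pose g (t : V) := \sum_a c a * expR (dotp (val a - x) t).
have gc : continuous g.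
  move=> t; apply: (@cvg_finsum _ _ _ (nbhs t)) => a.
  apply: cvgM; first exact: cvg_cst.
  apply: (@continuous_cvg _ _ _ (nbhs t) _ (dotp (val a - x)) expR).
    exact: continuous_expR.
  exact: dotp_continuousr.
(* A positive lower bound common to all the [c a]. *)
pose k := (\sum_a (c a)^-1)^-1.
have [a0 _] := hull_nonempty.
have sc a : (c a)^-1 <= \sum_a (c a)^-1.
  by rewrite (bigD1 a)//= lerDl sumr_ge0// => b _; rewrite invr_ge0 ltW.
have ks : 0 < \sum_a (c a)^-1 by rewrite (lt_le_trans _ (sc a0))// invr_gt0.
have k0 : 0 < k by rewrite invr_gt0.
have kc a : k <= c a by rewrite -[c a]invrK lef_pV2 ?posrE ?invr_gt0.
(* Coercivity: only the term selected by [interior_support] is kept, and [expR u >= 1 + u]. *)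
have glow t : k * (1 + r * `|t|) <= g t.
  have [a ra] := supp t; rewrite /g (bigD1 a)//=.
  apply: (@le_trans _ _ (c a * expR (dotp (val a - x) t))); last first.
    by rewrite lerDl sumr_ge0// => b _; rewrite mulr_ge0 ?expR_ge0// ltW.
  apply: ler_pM; [exact: ltW|by rewrite addr_ge0// mulr_ge0// ltW|exact: kc|].
  apply: le_trans (expR_ge1Dx _) _; rewrite ler_expR.
  exact: ra.
have g0 : 0 <= g 0.
  by apply: sumr_ge0 => a _; rewrite mulr_ge0 ?expR_ge0 ?ltW.
(* Outside the ball of radius [rho] the lower bound [glow] exceeds [g 0], so a minimum on the ball
   is a global one. *)
pose rho := g 0 / (k * r) + 1.
have rho0 : 0 < rho by rewrite ltr_wpDl// divr_ge0// mulr_ge0// ltW.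
have [t /set_mem tK tmin] : exists2 t, t \in closed_ball (0 : V) rho &
    forall s, s \in closed_ball (0 : V) rho -> g t <= g s.
  apply: EVT_min_rV; last exact: continuous_subspaceT.
    by exists 0; exact: closed_ballxx.
  apply: bounded_closed_compact; last exact: closed_ball_closed.
  exists rho; split; first exact: gtr0_real.
  move=> M Mrho s; rewrite closed_ballE//= /closed_ball_/= sub0r normrN => /le_trans.
  by apply; exact: ltW.
have tmin' s : g t <= g s.
  have [sr|sr] := leP `|s| rho.
    by apply: tmin; rewrite inE closed_ballE//= /closed_ball_/= sub0r normrN.
  have : g t <= g 0 by apply: tmin; rewrite inE; exact: closed_ballxx.
  move=> /le_trans; apply; apply: le_trans (glow s).
  have : g 0 / (k * r) <= `|s| by apply: ltW; apply: lt_trans sr; rewrite /rho; lra.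
  rewrite ler_pdivrMr ?mulr_gt0//; move: k0; rewrite mulrDr mulr1; nra.
(* This factor undoes the shift by [x] and normalises, turning the coefficients of the critical
   equation into the weights at [t]. *)
have /(congr1 (fun u => (expR (dotp x t) / Z t) *: u)) := exp_sum_critical tmin'.
rewrite scaler0 scaler_sumr => crit; exists t.
have [_ w1 _] := weight_barycentric t.
apply/eqP; rewrite -subr_eq0 -{1}[x]scale1r -{1}w1 scaler_suml -sumrB.
rewrite -[X in _ == X]crit; apply/eqP/eq_bigr => a _.
rewrite -scalerBr scalerA /weight; congr (_ *: _).
rewrite dotpBl expRD expRN -/(Z t); field.
by rewrite !lt0r_neq0 ?expR_gt0 ?partition_gt0.
Qed.

Lemma mu_ScK t : tau_Sc c (mu_Sc c t) = t.
Proof. by apply: pinvKV; rewrite ?inE//; move=> s u _ _; exact: mu_Sc_inj. Qed.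

Lemma tau_ScK x : P° x -> mu_Sc c (tau_Sc c x) = x.
Proof. by move=> /mu_Sc_surj[t <-]; rewrite mu_ScK. Qed.

(* Optimality conditions of the minimisation of the relative entropy
   [\sum_a p a * ln (p a / c a)] among the barycentric coordinates of [x]. *)
Definition entropy_optimal x (p : S -> R) : Prop :=
  barycentric x p /\ forall q, barycentric x q ->
    (forall a, p a = 0 -> q a = 0) /\
    \sum_a (q a - p a) * (ln (p a) - ln (c a)) = 0.

(** The two optimality identities, each tested on the other candidate, add up to a zero sum of the
    terms of [ln_monotone_le0]. The support conditions make [p] and [q] vanish at the same points,
    where the term is zero. *)
Lemma entropy_optimal_unique x p q :
  entropy_optimal x p -> entropy_optimal x q -> p =1 q.
Proof.
move=> [bp op] [bq oq] a.
have [pq hp] := op q bq; have [qp hq] := oq p bp.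
have term b : (q b - p b) * (ln (p b) - ln (q b)) <= 0 ?= iff (p b == q b).
  have [p0 _ _] := bp; have [q0 _ _] := bq.
  have [pb|pb] := eqVneq (p b) 0; first by rewrite pb pq// !subrr mul0r; split.
  have [qb|qb] := eqVneq (q b) 0; first by rewrite (qp _ qb) eqxx in pb.
  by apply: ln_monotone_le0; rewrite lt_def ?p0 ?q0 ?pb ?qb.
have : \sum_b (q b - p b) * (ln (p b) - ln (q b)) == 0.
  have := f_equal2 +%R hp hq; rewrite addr0 -big_split => h.
  by apply/eqP; rewrite -[RHS]h; apply: eq_bigr => b _ /=; ring.
rewrite -oppr_eq0 -sumrN psumr_eq0 => [/allP/(_ a)|b _]; last first.
  by rewrite oppr_ge0 term.
by rewrite mem_index_enum oppr_eq0 => /(_ isT) /=; rewrite term => /eqP.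
Qed.

Lemma weight_entropy_optimal t : entropy_optimal (mu_Sc c t) (weight c t).
Proof.
split=> [|q bq]; first exact: weight_barycentric.
split=> [a wa|]; last exact: mean_ln_weight (weight_barycentric t) bq.
by have := weight_gt0 t a; rewrite wa ltxx.
Qed.

(** * Continuous extension of the densities to the boundary *)

Let dens a x : R := weight c (tau_Sc c x) a.

Lemma dens_barycentric x : P° x -> barycentric x (dens ^~ x).
Proof. by move=> Px; have := weight_barycentric (tau_Sc c x); rewrite tau_ScK. Qed.

Lemma barycentric_le1 x (q : S -> R) a : barycentric x q -> q a <= 1.
Proof. by move=> [q0 q1 _]; rewrite -q1 (bigD1 a)//= lerDl sumr_ge0. Qed.

Lemma cvg_ln_dens (G : set_system V) {FG : Filter G} a (l : R) : 0 < l ->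
  dens a y @[y --> G] --> l ->
  ln (dens a y) - ln (c a) @[y --> G] --> ln l - ln (c a).
Proof.
move=> l0 dl; apply: cvgB; last exact: cvg_cst.
by apply: (continuous_cvg _ (continuous_ln l0) dl).
Qed.

(** Suppose [p b = 0 < q b]. In the mean identity for [q - p], every term other than that of [b] is
    bounded above along [G]: it converges if [p a > 0], and otherwise [dens a <= 1] bounds it. Hence
    [ln (dens b)] is bounded below, which excludes the limit 0. *)
Lemma dens_limit_supp (G : set_system V) x (p q : S -> R) b :
  ProperFilter G -> G P° -> barycentric x p -> barycentric x q ->
  (forall a, dens a y @[y --> G] --> p a) -> p b = 0 -> q b = 0.
Proof.
move=> PG GP bp bq dp pb; apply/eqP; apply: contraT => qb.
have [p0 _ _] := bp; have [q0 _ _] := bq.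
have qb0 : 0 < q b by rewrite lt_def qb q0.
have bnd a : exists C : R, \forall y \near G,
    (q a - p a) * (ln (dens a y) - ln (c a)) <= C.
  have [pa|pa] := eqVneq (p a) 0.
    exists (q a * (0 - ln (c a))); apply: filterS GP => y Py.
    rewrite pa subr0 ler_wpM2l// lerD2r ln_le0//.
    exact: barycentric_le1 (dens_barycentric Py).
  have pa0 : 0 < p a by rewrite lt_def pa p0.
  pose l := (q a - p a) * (ln (p a) - ln (c a)).
  have cl : (q a - p a) * (ln (dens a y) - ln (c a)) @[y --> G] --> l.
    by apply: cvgM; [exact: cvg_cst|exact: cvg_ln_dens].
  exists (l + 1); apply: (cvgr_le l cl); lra.
have [C HC] := choice bnd.
pose B := - \sum_(a | a != b) C a.
have nearB : \forall y \near G, expR (B / q b + ln (c b)) <= dens b y.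
  have : \forall y \near G, forall a,
      (q a - p a) * (ln (dens a y) - ln (c a)) <= C a.
    exact: filter_forall.
  move=> H; apply: filter_app H; apply: filterS GP => y Py HCy.
  have d0 : 0 < dens b y by exact: weight_gt0.
  rewrite -(lnK d0) ler_expR -lerBrDr ler_pdivrMr// mulrC.
  have := mean_ln_weight (tau_Sc c y) bp bq; rewrite (bigD1 b)//= pb subr0.
  have : \sum_(a | a != b) (q a - p a) * (ln (dens a y) - ln (c a)) <=
      \sum_(a | a != b) C a by apply: ler_sum.
  rewrite /B /dens; lra.
have : expR (B / q b + ln (c b)) <= p b.
  exact: cvg_ge_lim (dp b) nearB.
by rewrite pb leNgt expR_gt0.
Qed.

(** The mean identity holds for the weights at any parameter and for the fixed pair [p], [q], so it
    passes to the limit along [G]. Where [p a = 0] the coefficient is zero by the support condition,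
    so a divergent logarithm does no harm. *)
Lemma dens_limit_optimal (G : set_system V) x (p : S -> R) :
  ProperFilter G -> G P° -> barycentric x p ->
  (forall a, dens a y @[y --> G] --> p a) -> entropy_optimal x p.
Proof.
move=> PG GP bp dp; split=> // q bq.
have pq a : p a = 0 -> q a = 0 by exact: dens_limit_supp bp bq dp.
split=> //.
have cvgL : \sum_a (q a - p a) * (ln (dens a y) - ln (c a)) @[y --> G] -->
    \sum_a (q a - p a) * (ln (p a) - ln (c a)).
  apply: cvg_finsum => a; have [pa|pa] := eqVneq (p a) 0.
    rewrite pa pq// subrr mul0r; under eq_fun do rewrite mul0r.
    exact: cvg_cst.
  apply: cvgM; [exact: cvg_cst|apply: cvg_ln_dens (dp a)].
  by have [p0 _ _] := bp; rewrite lt_def pa p0.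
apply: (@cvg_unique R (@norm_hausdorff _ R) _ _ _ _ cvgL) => /=.
under eq_fun do rewrite (mean_ln_weight _ bp bq).
exact: cvg_cst.
Qed.

(** Along each ultrafilter refining the trace of the neighborhoods of [x] on [P°], the densities
    converge by compactness of [[0, 1]], and the limit is entropy optimal. Uniqueness makes all
    these limits equal, hence the trace itself converges. *)
Lemma dens_cvg x : P x -> exists p, entropy_optimal x p /\
  forall a, dens a y @[y --> within P° (nbhs x)] --> p a.
Proof.
move=> Px; have clx : closure P° x.
  by apply: interior_convex_dense Px => //; exact: convex_hull_convex.
have PF : ProperFilter (within P° (nbhs x)) by exact: within_nbhs_proper.
have ultra G : UltraFilter G -> within P° (nbhs x) `<=` G -> exists p,
    entropy_optimal x p /\ forall a, dens a y @[y --> G] --> p a.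
  move=> UG FG; have PG : ProperFilter G by exact: ultra_proper.
  have GP : G P° by apply: FG; exact: withinT.
  have /choice[p dp] a : exists l : R, dens a y @[y --> G] --> l.
    have [||l _] := @ultra_image_cvg _ R G (dens a) `[0, 1] UG; last by exists l.
      exact: segment_compact.
    apply: filterS GP => y /dens_barycentric by_ /=.
    by rewrite in_itv/= (barycentric_le1 _ by_) andbT; have [->] := by_.
  exists p; split=> //; apply: (dens_limit_optimal PG GP _ dp); split.
  - move=> a; apply: cvg_ge_lim (dp a) _.
    by apply: filterE => y; exact/ltW/weight_gt0.
  - apply: (@cvg_unique R (@norm_hausdorff _ R) _ _ _ _ (cvg_finsum dp)) => /=.
    have -> : (fun y => \sum_a dens a y) = cst 1.
      by apply/funext => y; have [] := weight_barycentric (tau_Sc c y).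
    exact: cvg_cst.
  - have dpv : \sum_a dens a y *: val a @[y --> G] --> \sum_a p a *: val a.
      by apply: cvg_finsum => a; exact: cvgZr_tmp (dp a).
    apply: (@cvg_unique V (@norm_hausdorff _ V) _ _ _ _ dpv) => /=.
    have Gx : G --> x.
      move=> A xA; apply: FG; rewrite /within /=.
      by apply: (@filterS _ (nbhs x) _ _ _ _ xA).
    apply: cvg_trans Gx; apply: (@near_eq_cvg _ _ G _ id).
    by apply: filterS GP => y /dens_barycentric[].
have [G0 [UG0 FG0]] := ultraFilterLemma PF.
have [p [op _]] := ultra _ UG0 FG0.
exists p; split=> // a; apply: cvg_ultraP => G UG FG.
have [q [oq dq]] := ultra _ UG FG.
by rewrite (entropy_optimal_unique op oq).
Qed.

Lemma m_Sc_exists : exists g : S -> V -> R, forall a,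
  {within P, continuous (g a)} /\ forall x, P° x -> g a x = weight c (tau_Sc c x) a.
Proof.
have /choice[g Hg] x : exists p : S -> R, P x -> entropy_optimal x p /\
    forall a, dens a y @[y --> within P° (nbhs x)] --> p a.
  have [/dens_cvg[p ?]|NP] := pselect (P x); first by exists p.
  by exists (fun=> 0).
exists (fun a x => g x a) => a; split; last first.
  move=> x Px; have [op _] := Hg x (interior_subset Px).
  have := weight_entropy_optimal (tau_Sc c x); rewrite tau_ScK//.
  by move=> /(entropy_optimal_unique op).
(* The bound [e] between [g x a] and the densities holds on the interior points of a whole
   neighborhood of [x]. It thus holds near each [y] of [P] close to [x], and passes to the limit
   [g y a]. *)
apply/subspace_continuousP => x Px; apply/cvgrPdist_le => e e0.
have [_ /(_ a)/cvgrPdist_le/(_ e e0) /nbhs_interior H] := Hg x Px.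
apply: (@filterS _ (nbhs x) _ _ _ _ H) => y Hy Py.
have [_ /(_ a) dy] := Hg y Py.
have PF : ProperFilter (within P° (nbhs y)).
  apply: within_nbhs_proper; apply: interior_convex_dense Py => //.
  exact: convex_hull_convex.
have cB : `|g x a - dens a z| @[z --> within P° (nbhs y)] --> `|g x a - g y a|.
  by apply: cvg_norm; apply: cvgB dy; exact: cvg_cst.
by apply: cvg_le_lim cB _; exact: Hy.
Qed.

Lemma m_ScP a : {within P, continuous (m_Sc P c a)} /\
  forall x, P° x -> m_Sc P c a x = weight c (tau_Sc c x) a.
Proof.
have [g Hg] := m_Sc_exists.
exact: (@xgetPex _ (fun=> 0) [set g : V -> R | {within P, continuous g} /\
  forall x, P° x -> g x = weight c (tau_Sc c x) a] (ex_intro _ (g a) (Hg a))).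
Qed.

(** By continuity on [P], the value at [x] is the limit along [P°] given by [dens_cvg], and that
    limit is a system of barycentric coordinates of [x]. *)
Lemma m_Sc_barycentric x : P x -> barycentric x (m_Sc P c ^~ x).
Proof.
move=> Px; have cP : @convex_set R V P by exact: convex_hull_convex.
have clx : closure P° x by exact: interior_convex_dense.
have PF : ProperFilter (within P° (nbhs x)) by exact: within_nbhs_proper.
have [p [[bp _] dp]] := dens_cvg Px.
have -> // : m_Sc P c ^~ x = p.
apply/funext => a; have [/subspace_continuousP/(_ x Px) cm mE] := m_ScP a.
apply/esym/(@cvg_unique R (@norm_hausdorff _ R) _ _ _ _ (dp a)) => /=.
have sub : within P° (nbhs x) `=>` within P (nbhs x).
  by move=> A; apply: (@filterS _ (nbhs x)) => y Ay /interior_subset; exact: Ay.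
apply: cvg_trans _ (cvg_trans (cvg_app _ sub) cm); apply: near_eq_cvg.
by apply: (@filterE _ (nbhs x)) => y /mE.
Qed.

Lemma dens_continuous a x : P° x -> {for x, continuous (dens a)}.
Proof.
move=> Px; have [/subspace_continuousP/(_ x (interior_subset Px)) cm mE] := m_ScP a.
rewrite /prop_for /continuous_at /dens -mE//.
have nP : nbhs x P° by exact: open_nbhs_nbhs (conj (@open_interior _ P) Px).
have sub : nbhs x `=>` within P (nbhs x).
  move=> A HA; apply: (@filterS2 _ (nbhs x) _ _ _ _ _ nP HA) => y /interior_subset Py; exact.
apply: cvg_trans _ (cvg_trans (cvg_app _ sub) cm).
apply: (@near_eq_cvg _ _ (nbhs x)).
by apply: (@filterS _ (nbhs x) _ _ _ _ nP) => y /mE.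
Qed.

(** The increment of [tau_Sc], paired with [a - b], is an increment of a difference of
    log-densities, continuous inside [P°]. Writing [x] as a barycenter of the [b],
    [interior_support] bounds the norm of the increment by the sum [N], which tends to 0. *)
Lemma tau_Sc_continuous x : P° x -> {for x, continuous (tau_Sc c)}.
Proof.
move=> Px; have [r r0 supp] := interior_support Px.
have /convex_hull_fsetP[q [q0 q1 qx]] := interior_subset Px.
pose L a y := ln (dens a y) - ln (c a).
have LE a b y z : dotp (val a - val b) (tau_Sc c y - tau_Sc c z) =
    (L a y - L b y) - (L a z - L b z).
  by rewrite dotpBl !dotpBr /L /dens !ln_weight; ring.
pose N y := \sum_a \sum_b `|(L a y - L b y) - (L a x - L b x)|.
have Nle y : r * `|tau_Sc c y - tau_Sc c x| <= N y.
  have [a ra] := supp (tau_Sc c y - tau_Sc c x); apply: (le_trans ra).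
  rewrite -[x in dotp (_ - x)]qx -[val a]scale1r -q1 scaler_suml -sumrB dotp_suml.
  rewrite /N [leRHS](bigD1 a)//= -[leLHS]addr0 lerD//; last first.
    by apply: sumr_ge0 => b _; exact: sumr_ge0.
  apply: ler_sum => b _; rewrite -scalerBr dotpZl LE.
  apply: (le_trans (ler_norm _)); rewrite normrM ler_piMl// ger0_norm//.
  by rewrite -q1 (bigD1 b)//= lerDl sumr_ge0.
have N0 : N y @[y --> x] --> 0.
  have -> : 0 = \sum_(a : S) \sum_(b : S) `|(L a x - L b x) - (L a x - L b x)|.
    by rewrite big1// => a _; rewrite big1// => b _; rewrite subrr normr0.
  have cL a : L a y @[y --> x] --> L a x.
    by apply: (@cvg_ln_dens (nbhs x)); [exact: weight_gt0|exact: dens_continuous].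
  apply: (@cvg_finsum _ _ _ (nbhs x)) => a; apply: (@cvg_finsum _ _ _ (nbhs x)) => b.
  apply: (@cvg_norm _ _ _ (nbhs x)); apply: cvgB; last exact: cvg_cst.
  by apply: cvgB.
apply/(@cvgrPdist_le _ _ _ (nbhs x)) => e e0.
have /(@cvgrPdist_le _ _ _ (nbhs x))/(_ (r * e)) := N0.
rewrite mulr_gt0// => /(_ isT) H.
apply: (@filterS _ (nbhs x) _ _ _ _ H) => y; rewrite sub0r normrN distrC.
by move=> /(le_trans (ler_norm _))/(le_trans (Nle y)); rewrite ler_pM2l.
Qed.

(** * Derivatives of the weights, of [mu_Sc] and of its inverse *)

Lemma differentiable_dotp (a t : V) : differentiable (dotp a) t.
Proof.
apply: differentiable_finsum => i; apply: differentiableM.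
  exact: differentiable_cst.
exact: differentiable_coord.
Qed.

Lemma derive_dotp (a t v : V) : 'D_v (dotp a) t = dotp a v.
Proof.
have d i : is_derive t v (fun y : V => a 0 i * y 0 i) (a 0 i * v 0 i).
  have H : is_derive t v (fun y : V => y 0 i) (v 0 i).
    apply: DeriveDef; last exact: derive_coord.
    exact/diff_derivable/differentiable_coord.
  by have := is_deriveZ (a 0 i) H; exact.
exact: (@derive_val _ _ _ _ _ _ _ (is_derive_finsum d)).
Qed.

Lemma is_derive_exp_weight a (t v : V) :
  is_derive t v (fun t => c a * expR (dotp (val a) t))
    (c a * (expR (dotp (val a) t) * dotp (val a) v)).
Proof.
have H := is_derive_expR_comp (differentiable_dotp (val a) t) (derive_dotp _ t v).
by have := is_deriveZ (c a) H; exact.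
Qed.

Lemma differentiable_exp_weight a (t : V) :
  differentiable (fun t => c a * expR (dotp (val a) t)) t.
Proof.
apply: differentiableM; first exact: differentiable_cst.
exact/differentiable_expR_comp/differentiable_dotp.
Qed.

Lemma differentiable_partition t : differentiable Z t.
Proof. by apply: differentiable_finsum => a; exact: differentiable_exp_weight. Qed.

Lemma derive_partition (t v : V) : 'D_v Z t = Z t * dotp (mu_Sc c t) v.
Proof.
rewrite (@derive_val _ _ _ _ _ _ _ (is_derive_finsum
  (fun a => is_derive_exp_weight a t v))).
rewrite dotp_suml mulr_sumr; apply: eq_bigr => a _; rewrite dotpZl /weight -/(Z t).
by field; rewrite lt0r_neq0// partition_gt0.
Qed.

Lemma differentiable_weight a t : differentiable (weight c ^~ a) t.
Proof.
apply: differentiableM; first exact: differentiable_exp_weight.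
apply: differentiableV; first exact: differentiable_partition.
by rewrite lt0r_neq0// partition_gt0.
Qed.

Lemma derive_weight a (t v : V) :
  'D_v (weight c ^~ a) t = weight c t a * dotp (val a - mu_Sc c t) v.
Proof.
have Z0 : Z t != 0 by rewrite lt0r_neq0// partition_gt0.
have dZ : derivable Z t v by exact/diff_derivable/differentiable_partition.
have dE := is_derive_exp_weight a t v.
have := @deriveM _ _ (fun t => c a * expR (dotp (val a) t)) (fun t => (Z t)^-1) t v
  (@ex_derive _ _ _ _ _ _ _ dE) (derivableV Z0 dZ).
rewrite deriveV// derive_partition (@derive_val _ _ _ _ _ _ _ dE) => H.
rewrite [LHS]H /weight -/(Z t) dotpBl /GRing.scale /=; field.
exact: Z0.
Qed.

Definition cov (t : V) : 'M[R]_m :=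
  \sum_a weight c t a *: ((val a - mu_Sc c t)^T *m (val a - mu_Sc c t)).

Lemma mulmx_cov (v t : V) : v *m cov t =
  \sum_a (weight c t a * dotp (val a - mu_Sc c t) v) *: (val a - mu_Sc c t).
Proof.
rewrite mulmx_sumr; apply: eq_bigr => a _.
rewrite -scalemxAr mulmxA mulmx_trmx_dotp mul_scalar_mx scalerA dotpC.
by [].
Qed.

Lemma cov_sym t : (cov t)^T = cov t.
Proof.
by rewrite linear_sum; apply: eq_bigr => a _; rewrite linearZ/= trmx_mul trmxK.
Qed.

(** The quadratic form of [cov t] at [v] is the variance of [dotp (val a) v]. If it vanishes, this
    pairing is constant on [S], which forces [v = 0]. *)
Lemma cov_unit t : cov t \in unitmx.
Proof.
rewrite -row_free_unit; apply: inj_row_free => v.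
rewrite mulmx_cov => /(congr1 (fun u => dotp u v)); rewrite dotp0l dotp_suml => /eqP.
rewrite psumr_eq0 => [/allP vS|a _]; last first.
  by rewrite dotpZl -mulrA mulr_ge0 ?sqr_ge0// ltW// weight_gt0.
apply: (dotp_cst_eq0 (k := dotp (mu_Sc c t) v) P0) => a.
have := vS a; rewrite mem_index_enum dotpZl => /(_ isT) /=.
rewrite mulf_eq0 mulf_eq0 (gt_eqF (weight_gt0 t a)) /= orbb dotpBl subr_eq0.
by move/eqP.
Qed.

Lemma differentiable_mu t : differentiable (mu_Sc c) t.
Proof.
apply: differentiable_finsum => a; apply: differentiableZl.
exact: differentiable_weight.
Qed.

Lemma diff_mu t : 'd (mu_Sc c) t = mulmxr (cov t) :> (V -> V).
Proof.
apply/funext => v; rewrite -deriveE; last exact: differentiable_mu.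
have d a : is_derive t v (fun t => weight c t a *: val a)
    ((weight c t a * dotp (val a - mu_Sc c t) v) *: val a).
  apply: DeriveDef.
    apply: diff_derivable; apply: differentiableZl.
    exact: differentiable_weight.
  rewrite deriveE; last by apply: differentiableZl; exact: differentiable_weight.
  rewrite diffZl; last exact: differentiable_weight.
  by rewrite -deriveE ?derive_weight//; exact: differentiable_weight.
rewrite [LHS](@derive_val _ _ _ _ _ _ _ (is_derive_finsum d)) /= mulmx_cov.
(* Centering: thanks to this, [val a] may be replaced by [val a - mu_Sc c t] in the derivative,
   which produces the covariance. *)
have mean0 : \sum_a weight c t a * dotp (val a - mu_Sc c t) v = 0.
  have [_ w1 _] := weight_barycentric t.
  under eq_bigr do rewrite dotpBl mulrBr.
  rewrite sumrB -mulr_suml w1 mul1r /mu_Sc dotp_suml -sumrB big1// => a _.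
  by rewrite dotpZl subrr.
under [RHS]eq_bigr do rewrite scalerBr.
by rewrite sumrB -scaler_suml mean0 scale0r subr0.
Qed.

Lemma diff_tau x : P° x -> differentiable (tau_Sc c) x /\
  'd (tau_Sc c) x = mulmxr (invmx (cov (tau_Sc c x))) :> (V -> V).
Proof.
move=> Px; apply: (differentiable_inverse (differentiable_mu _) (diff_mu _)).
- exact: cov_unit.
- exact: tau_Sc_continuous.
- have nP : nbhs x P° by exact: open_nbhs_nbhs (conj (@open_interior _ P) Px).
  by apply: (@filterS _ (nbhs x) _ _ _ _ nP) => y /tau_ScK.
Qed.

Lemma differentiable_dens a x : P° x -> differentiable (dens a) x.
Proof.
move=> /diff_tau[dt _].
apply: (@differentiable_comp _ _ _ _ (tau_Sc c) (weight c ^~ a)) => //.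
exact: differentiable_weight.
Qed.

Lemma derive_dens a x v : P° x -> 'D_v (dens a) x =
  dens a x * dotp (val a - x) (v *m invmx (cov (tau_Sc c x))).
Proof.
move=> Px; have [dt dtE] := diff_tau Px.
rewrite deriveE; last exact: differentiable_dens.
rewrite (@diff_comp _ _ _ _ (tau_Sc c) (weight c ^~ a))//; last first.
  exact: differentiable_weight.
rewrite /= dtE -(deriveE _ (differentiable_weight a _)) derive_weight.
by rewrite tau_ScK.
Qed.

Lemma cov_coef x i j : P° x ->
  cov (tau_Sc c x) i j = \sum_a dens a x * ((val a 0 i - x 0 i) * (val a 0 j - x 0 j)).
Proof.
move=> Px; rewrite summxE; apply: eq_bigr => a _.
by rewrite tau_ScK// !mxE big_ord1 !mxE.
Qed.

(* The densities solve the closed system [derive_dens], whose right-hand side is a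
   rational expression in the densities and the coordinates. *)
Lemma dens_invcov_Ck k : (forall a, Ck_on P° k (dens a)) /\
  forall i j, Ck_on P° k (fun x => invmx (cov (tau_Sc c x)) i j).
Proof.
have oP : open P° by exact: open_interior.
have step k' : (forall a, Ck_on P° k' (dens a)) ->
    forall i j, Ck_on P° k' (fun x => invmx (cov (tau_Sc c x)) i j).
  move=> Cd; apply: Ck_on_invmx => // [x _|i j]; first exact: cov_unit.
  apply: (eq_Ck_on oP (fun x Px => esym (cov_coef i j Px))).
  have Ccoord (a : S) l : Ck_on P° k' (fun x : V => val a 0 l - x 0 l).
    apply: (eq_Ck_on oP (f := fun x : V => val a 0 l + (-1) * x 0 l)).
      by move=> x _; rewrite mulN1r.
    apply: Ck_onD => //; first exact: Ck_on_cst.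
    by apply: Ck_onM => //; [exact: Ck_on_cst|exact: Ck_on_coord].
  apply: Ck_on_sum => // a; apply: Ck_onM => //; exact: Ck_onM.
suff Cd : forall a, Ck_on P° k (dens a) by split=> //; exact: step.
elim: k => [|k IH] a; first by move=> x Px; exact: dens_continuous.
split=> [x Px|v]; first exact: differentiable_dens.
apply: (eq_Ck_on oP (fun x Px => esym (derive_dens a v Px))).
apply: Ck_onM => //.
apply: Ck_on_sum => // i; apply: Ck_onM => //.
  apply: (eq_Ck_on oP (f := fun x : V => val a 0 i + (-1) * x 0 i)).
    by move=> x _; rewrite !mxE mulN1r.
  apply: Ck_onD => //; first exact: Ck_on_cst.
  by apply: Ck_onM => //; [exact: Ck_on_cst|exact: Ck_on_coord].
apply: (eq_Ck_on oP
  (f := fun x => \sum_j v 0 j * invmx (cov (tau_Sc c x)) j i)) => [x _|].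
  by rewrite mxE.
apply: Ck_on_sum => // j; apply: Ck_onM => //; first exact: Ck_on_cst.
exact: step.
Qed.

End Toric.

Lemma cvg_initial {X : choiceType} {Y : topologicalType} (f : X -> Y)
    (F : set_system X) {FF : Filter F} (x : X) :
  f @ F --> f x -> F --> (x : initial_topology f).
Proof.
move=> fx A [_ [[B oB <-] Bfx] BA]; apply: filterS BA _.
by apply: fx; exact: open_nbhs_nbhs.
Qed.

(** * Weak-* continuity, Borel sets and finitely supported measures *)

Section BorelV.
Context {R : realType} {m : nat}.
Local Notation V := 'rV[R]_m.
Implicit Types (P : set V) (S : {fset V}).

(** The topology is initial in two stages, for [pairing] and then for the evaluations at each [f],
    so convergence is tested on one [f] at a time. *)
Lemma weak_star_continuous P (B : V -> prob_on P) :
  (forall f : contfun P, {within P, continuous (Bop B f)}) ->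
  {within P, continuous B}.
Proof.
move=> cB; apply/subspace_continuousP => x Px.
apply: (@cvg_initial _ _ (@pairing R m P)).
apply/cvg_sup => f; apply: cvg_initial.
by have /subspace_continuousP/(_ x Px) := cB f.
Qed.

Lemma borel_open (U : set V) : open U -> measurable (U : set (@borelV R m)).
Proof. by move=> oU; exact: sub_sigma_algebra. Qed.

Lemma borel_closed (A : set V) : closed A -> measurable (A : set (@borelV R m)).
Proof. by move/closed_openC/borel_open/measurableC; rewrite setCK. Qed.

Lemma borel_set1 (a : V) : measurable ([set a] : set (@borelV R m)).
Proof.
apply: borel_closed; apply: accessible_closed_set1; apply: hausdorff_accessible.
exact: norm_hausdorff.
Qed.

Lemma fset_closed S : closed [set` S].
Proof.
apply: compact_closed; first exact: norm_hausdorff.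
by apply: finite_compact; exact: finite_fset.
Qed.

Lemma within_continuous_measurable P (f : V -> R) : closed P ->
  {within P, continuous f} ->
  measurable_fun (P : set (@borelV R m)) (f : @borelV R m -> R).
Proof.
move=> cP /continuousP cf; apply: (measurability _ (RGenOpens.measurableE R)).
move=> _ [_ [a [b ->] <-]].
have oI : open (`]a, b[%classic : set R) by exact: interval_open.
have /open_subspaceP[U oU UP] := cf _ oI.
by rewrite setIC -UP; apply: measurableI; [exact: borel_open|exact: borel_closed].
Qed.

Definition atomic S (p : S -> R) (A : set (@borelV R m)) : \bar R :=
  (\sum_a (p a)%:E * \d_(val a : @borelV R m) A)%E.

Section AtomicMeasure.
Variables (S : {fset V}) (a0 : S) (p : S -> R).
Hypothesis p0 : forall a, 0 <= p a.

(** [msum] adds a sequence of measures, hence the enumeration of [S] by natural numbers; [a0] is the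
    default value of [nth]. *)
Let atom k : S := nth a0 (enum {: S}) k.

Let part k : {measure set (@borelV R m) -> \bar R} :=
  mscale (NngNum (p0 (atom k))) (\d_(val (atom k) : @borelV R m)).

Let mu : {measure set (@borelV R m) -> \bar R} := msum part #|{: S}|.

Let sum_atoms (F : S -> \bar R) : (\sum_(k < #|{: S}|) F (atom k) = \sum_a F a)%E.
Proof.
rewrite [RHS](perm_big (enum {: S})) /=; last first.
  apply: uniq_perm; rewrite ?index_enum_uniq ?enum_uniq// => a.
  by rewrite mem_index_enum mem_enum.
by rewrite (big_nth a0) big_mkord cardE.
Qed.

Lemma atomic_measure_ex : exists2 nu : {measure set (@borelV R m) -> \bar R},
  nu = atomic p :> (set (@borelV R m) -> \bar R) &
  forall (D : set (@borelV R m)) (f : @borelV R m -> \bar R),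
    measurable D -> measurable_fun D f -> (forall x, D x -> (0 <= f x)%E) ->
    (forall a : S, D (val a)) ->
    (\int[nu]_(x in D) f x = \sum_a (p a)%:E * f (val a))%E.
Proof.
exists mu.
  apply/funext => A.
  exact: sum_atoms (fun a => (p a)%:E * \d_(val a : @borelV R m) A)%E.
move=> D f mD mf f0 DS; rewrite ge0_integral_measure_sum//.
rewrite -(sum_atoms (fun a => (p a)%:E * f (val a))%E); apply: eq_bigr => k _.
rewrite ge0_integral_mscale// integral_dirac// diracE mem_set ?mul1e//.
Qed.

(** [nu] agrees with the sum of Dirac masses on Borel sets only, which is enough to replace it by a
    genuine such measure under the integral. The formula for nonnegative functions is then applied
    to the positive and negative parts of [f]. *)
Lemma Rintegral_atomic (nu : probability (@borelV R m) R) P (f : V -> R) :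
  closed P -> [set` S] `<=` P ->
  (forall A, measurable A -> nu A = atomic p A) -> {within P, continuous f} ->
  \int[nu]_(z in P) f z = \sum_a p a * f (val a).
Proof.
move=> cP SP nuE cf; have [mu' mu'E intE] := atomic_measure_ex.
have mP : measurable (P : set (@borelV R m)) by exact: borel_closed.
have mf : measurable_fun (P : set (@borelV R m)) (EFin \o f : @borelV R m -> \bar R).
  by apply/measurable_EFinP; exact: within_continuous_measurable.
have DS (a : S) : P (val a) by apply: SP; exact: valP a.
rewrite /Rintegral (@eq_measure_integral _ _ _ _ mu' nu); last first.
  by move=> A mA _; rewrite mu'E; exact: nuE.
rewrite integralE (intE _ _ mP (measurable_funepos mf))//.
rewrite (intE _ _ mP (measurable_funeneg mf))//.
have posE (a : S) : ((p a)%:E * (EFin \o f)^\+ (val a) = (p a * Num.max (f (val a)) 0)%:E)%E.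
  by rewrite funeposE /= -EFin_max EFinM.
have negE (a : S) : ((p a)%:E * (EFin \o f)^\- (val a) = (p a * Num.max (- f (val a)) 0)%:E)%E.
  by rewrite funenegE /= -EFin_max EFinM.
under eq_bigr do rewrite posE.
under [X in (_ - X)%E]eq_bigr do rewrite negE.
rewrite !sumEFin -EFinB /= -sumrB; apply: eq_bigr => a _.
rewrite -mulrBr; congr (_ * _).
by case: (leP (f (val a)) 0) => h; case: (leP (- f (val a)) 0) => h'; lra.
Qed.

Lemma atomic_probability_ex : \sum_a p a = 1 ->
  exists nu : probability (@borelV R m) R, forall A, nu A = atomic p A.
Proof.
move=> p1; have [mu' mu'E _] := atomic_measure_ex.
have mu'T : mu' setT = 1%E.
  rewrite mu'E /atomic; under eq_bigr do rewrite diracT mule1.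
  by rewrite sumEFin p1.
(* Normalising provides the probability structure and changes nothing, as the total mass is 1; the
   Dirac measure is the fallback for a zero or infinite mass. *)
exists (mnormalize mu' (\d_(val a0 : @borelV R m))) => A.
by rewrite -mu'E /= /mnormalize mu'T onee_eq0 /= invr1 mule1.
Qed.

Lemma atomic_compl_supp : atomic p (~` [set` S]) = 0%E.
Proof.
rewrite /atomic big1// => a _; rewrite diracE memNset ?mule0//.
by move=> /=; apply; exact: valP a.
Qed.

Lemma atomic_isolate a : atomic p (~` [set` S] `|` [set val a]) = (p a)%:E.
Proof.
rewrite /atomic (bigD1 a)//= diracE mem_set; last by right.
rewrite mule1 big1 ?adde0// => b ba; rewrite diracE memNset ?mule0//.
move=> /= [|/val_inj ab]; first by apply; exact: valP b.
by rewrite ab eqxx in ba.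
Qed.

End AtomicMeasure.

(** A neighborhood of [a] that meets [S] in [a] only: if [a] lies in the support of a measure
    carried by [S], it shows that the mass at [a] is positive. *)
Lemma open_isolate S (a : S) : open (~` [set` S] `|` [set val a] : set V).
Proof.
have -> : ~` [set` S] `|` [set val a] = ~` [set` (S `\ val a)%fset].
  apply/seteqP; split=> [z [zS|->]|z /= zS].
  - by rewrite /= !inE => /andP[_]; exact: zS.
  - by rewrite /= !inE eqxx.
  - have [->|za] := eqVneq z (val a); first by right.
    by left => zS'; apply: zS; rewrite !inE za.
by apply: closed_openC; exact: fset_closed.
Qed.

(** Each point of [P] outside [S] has a null open neighborhood. The part [C n] of [P] at distance at
    least [1 / (n + 1)] from [S] is compact, hence covered by finitely many of these, and the [C n]
    together with the complement of [P] cover the complement of [S]. *)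
Lemma supp_sub_null P S (nu : probability (@borelV R m) R) : compact P ->
  nu P = 1%E -> supp nu `<=` [set` S] -> nu (~` [set` S]) = 0%E.
Proof.
move=> coP nuP suppS.
have cP : closed P by apply: compact_closed => //; exact: norm_hausdorff.
have mP : measurable (P : set (@borelV R m)) by exact: borel_closed.
have mS : measurable (~` [set` S] : set (@borelV R m)).
  by apply: borel_open; apply: closed_openC; exact: fset_closed.
pose C n : set V := P `&` [set z | forall a : S, n.+1%:R^-1 <= `|z - val a|].
have CN n : nu.-negligible (C n : set (@borelV R m)).
  have cC : compact (C n).
    apply: compact_closedI => //.
    have -> : [set z : V | forall a : S, n.+1%:R^-1 <= `|z - val a|] =
        \bigcap_(a : S) ((fun z => `|z - val a|) @^-1` [set x | n.+1%:R^-1 <= x]).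
      by apply/seteqP; split=> z; [move=> H a _; exact: H|move=> H a; exact: H].
    apply: closed_bigI => a _; apply: closed_comp; last exact: closed_ge.
    move=> z _; apply: (@cvg_norm _ _ _ (nbhs z)).
    by apply: cvgB; [exact: cvg_id|exact: cvg_cst].
  rewrite compact_cover in cC.
  have [||D' D'D CD'] := cC (set V) [set U | open U /\ nu U = 0%E] id.
  - by move=> U [].
  - move=> z [Pz zC]; apply: contrapT => Nz.
    have : [set` S] z.
      apply: suppS => U oU Uz; rewrite lt_def measure_ge0 andbT; apply/eqP => U0.
      by apply: Nz; exists U.
    move=> /= zS; have := zC (FSetSub zS).
    by rewrite /= subrr normr0 leNgt invr_gt0 ltr0n.
  - apply: (@negligibleS _ _ _ nu (cover [set` D'] id) _ CD'); rewrite /cover.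
    have -> : \bigcup_(i in [set` D']) i = \big[setU/set0]_(i <- D') i.
      by rewrite bigcup_fset.
    rewrite big_seq; elim/big_ind : _ => [||U /D'D].
    + exact: negligible_set0.
    + by move=> X Y; exact: (@negligibleU _ _ _ nu X Y).
    + by rewrite inE => -[oU U0]; apply/negligibleP => //; exact: borel_open.
apply/(@negligibleP _ _ _ nu _ mS).
apply: (@negligibleS _ _ _ nu (~` P `|` \bigcup_n C n)) => [z zS|].
  have [Pz|] := pselect (P z); [right|by left].
  have : (~` [set` S])° z.
    have oS : open (~` [set` S] : set V) by apply: closed_openC; exact: fset_closed.
    by move/interior_id : oS => ->.
  move=> /nbhs_ballP[e /= e0 eS].
  pose n := Num.truncn e^-1.
  have ne : n.+1%:R^-1 < e.
    by rewrite invf_plt ?posrE// truncnS_gt.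
  exists n => //; split=> // a; rewrite leNgt; apply/negP => za.
  apply: (eS (val a)); last exact: valP a.
  by rewrite -ball_normE /=; exact: lt_trans ne.
apply: negligibleU; last exact: negligible_bigcup.
apply/negligibleP; first exact: measurableC.
have := probability_setC nu mP; rewrite nuP subee//; exact.
Qed.

Lemma probability_atomic S (nu : probability (@borelV R m) R) :
  nu (~` [set` S]) = 0%E ->
  forall A, measurable A -> nu A = atomic (fun a : S => fine (nu [set val a])) A.
Proof.
move=> nu0 A mA.
have mS : measurable ([set` S] : set (@borelV R m)) by apply: borel_closed; exact: fset_closed.
have -> : nu A = nu (A `&` [set` S]).
  rewrite -(measureU0 (A := A `&` [set` S]) (B := A `&` ~` [set` S]))//.
  - by rewrite -setIUr setUv setIT.
  - exact: measurableI.
  - by apply: measurableI => //; exact: measurableC.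
  - apply/eqP; rewrite -measure_le0 -nu0; apply: le_measure; rewrite ?inE//.
      by apply: measurableI => //; exact: measurableC.
    exact: measurableC.
have -> : A `&` [set` S] = \bigcup_(a in [set` index_enum S]) (A `&` [set val a]).
  apply/seteqP; split=> [z [Az zS]|z [a _ [Az za]]]; last first.
    by split=> //; rewrite za; exact: fsvalP.
  by exists (FSetSub zS) => //=; rewrite mem_index_enum.
rewrite measure_fin_bigcup; last 3 first.
- exact: finite_seq.
- by apply/trivIsetP => a b _ _ ab; rewrite setIACA setIid; apply/seteqP; split => // z
    [_ [-> /val_inj /eqP]]; rewrite (negbTE ab).
- by move=> a _; apply: measurableI => //; exact: borel_set1.
rewrite -fsbig_seq ?index_enum_uniq//; apply: eq_bigr => a _.
rewrite fineK ?fin_num_measure//; last exact: borel_set1.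
rewrite diracE; have [aA|aA] := boolP (val a \in A).
  by rewrite mule1; congr (nu _); apply/seteqP; split=> [z []//|z ->]; split => //; exact/set_mem.
rewrite mule0 (_ : _ `&` _ = set0) ?measure0//; apply/seteqP; split=> // z [Az za].
by move: Az; rewrite za => /mem_set; rewrite (negbTE aA).
Qed.

End BorelV.

(** * Logarithmic derivatives, gradients and linear systems *)

Section LogDerivative.
Context {R : realType} {V : normedModType R}.

Lemma differentiable_ln_comp (f : V -> R) (x : V) : 0 < f x ->
  differentiable f x -> differentiable (fun y => ln (f y)) x.
Proof.
move=> f0 df; apply: (@differentiable_comp _ _ _ _ f (@ln R)) => //.
by apply/derivable1_diffP; have [] := is_derive1_ln f0.
Qed.

Lemma derive_ln_comp (f : V -> R) (x v : V) : 0 < f x -> differentiable f x ->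
  'D_v (fun y => ln (f y)) x = (f x)^-1 * 'D_v f x.
Proof.
move=> f0 df; have dl : derivable (@ln R) (f x) 1 by have [] := is_derive1_ln f0.
rewrite deriveE; last exact: differentiable_ln_comp.
rewrite (@diff_comp _ _ _ _ f (@ln R))//; last exact/derivable1_diffP.
rewrite /= deriv1E// derive1E (@derive_val _ _ _ _ _ _ _ (is_derive1_ln f0)).
by rewrite deriveE// mulrC.
Qed.

End LogDerivative.

Section Gradient.
Context {R : realType} {m : nat}.
Local Notation V := 'rV[R]_m.

Lemma derive_grad (f : V -> R) (x v : V) : differentiable f x ->
  'D_v f x = dotp (grad f x) v.
Proof.
move=> df; rewrite deriveE// {1}[v]row_sum_delta linear_sum; apply: eq_bigr => i _.
by rewrite linearZ /= mxE deriveE// mulrC.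
Qed.

(** Mean value theorem along the segment from [x] to [y]. *)
Lemma derive0_cst (U : set V) (f : V -> R) (x y : V) :
  (forall t : R, 0 <= t <= 1 -> U (t *: y + (1 - t) *: x)) ->
  (forall z, U z -> differentiable f z) ->
  (forall z v, U z -> 'D_v f z = 0) -> f x = f y.
Proof.
move=> Uxy df Df.
pose l (t : R) : V := t *: y + (1 - t) *: x; pose h t := f (l t).
have lE (t : R) : l t = t *: (y - x) + x.
  by rewrite /l; apply/rowP => i; rewrite !mxE; ring.
have dl (t : R) : differentiable l t.
  have -> : l = (fun t : R => t *: (y - x)) + cst x.
    by apply/funext => s; exact: lE.
  apply: differentiableD; last exact: differentiable_cst.
  exact: differentiableZl.
have dh (t : R) : 0 <= t <= 1 -> is_derive t 1 h 0.
  move=> /Uxy Ut; have dft : differentiable f (l t) by exact: df.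
  have dh : differentiable h t by exact: (@differentiable_comp _ _ _ _ l f).
  apply: DeriveDef; first exact: diff_derivable.
  by rewrite deriveE// (@diff_comp _ _ _ _ l f)//= -deriveE// Df.
have [||t _] := @MVT_segment _ h (fun=> 0) 0 1 ler01.
- by move=> t; rewrite in_itv/= => /andP[t0 t1]; apply: dh; lra.
- by apply: derivable_within_continuous => t; rewrite in_itv/= => /dh[].
rewrite mul0r /h /l !scale1r !subrr !scale0r subr0 scale1r add0r addr0.
by move/eqP; rewrite subr_eq0 => /eqP.
Qed.

(** Fredholm alternative: the columns of [cokermx A] are linear relations between the [u i], so the
    hypothesis says that the row [psi] is killed by them, hence lies in the row space of [A]. *)
Lemma dotp_solution (I : finType) (u : I -> V) (psi : I -> R) :
  (forall l : I -> R, \sum_i l i *: u i = 0 -> \sum_i l i * psi i = 0) ->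
  exists t : V, forall i, psi i = dotp (u i) t.
Proof.
move=> H.
pose A : 'M[R]_(m, #|I|) := \matrix_(k, i) u (enum_val i) 0 k.
pose r : 'rV[R]_#|I| := \row_i psi (enum_val i).
have sumI (W : zmodType) (F : I -> W) : \sum_i F i = \sum_(i < #|I|) F (enum_val i).
  by rewrite -(big_enum_val (A := I) F); apply: eq_bigl.
have /submxP[t rt] : (r <= A)%MS.
  rewrite submxE; apply/eqP/rowP => j; rewrite [RHS]mxE mxE.
  pose l i := cokermx A (enum_rank i) j.
  transitivity (\sum_i l i * psi i).
    rewrite sumI; apply: eq_bigr => i _; rewrite /l enum_valK [r _ _]mxE; exact: mulrC.
  apply: H; rewrite sumI; apply/rowP => k.
  have /matrixP/(_ k j) := mulmx_coker A; rewrite mxE [RHS]mxE => E.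
  rewrite [RHS]mxE -[RHS]E summxE; apply: eq_bigr => i _.
  by rewrite mxE [A _ _]mxE /l enum_valK mulrC.
exists t => i; have /rowP/(_ (enum_rank i)) := rt; rewrite !mxE enum_rankK => ->.
by apply: eq_bigr => k _; rewrite mxE enum_rankK mulrC.
Qed.

End Gradient.

(** * Integrals against a family of measures carried by [S] *)

Section AtomicBernstein.
Context {R : realType} {m : nat}.
Local Notation V := 'rV[R]_m.
Variables (P : set V) (S : {fset V}) (B : V -> prob_on P) (p : S -> V -> R).
Hypothesis cP : closed P.
Hypothesis SP : [set` S] `<=` P.
Hypothesis p0 : forall a x, P x -> 0 <= p a x.
Hypothesis Bp : forall x, P x -> forall A, measurable A -> B x A = atomic (p ^~ x) A.

Lemma atomic_sum1 x : P x -> \sum_a p a x = 1.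
Proof.
move=> Px; have := Bp Px measurableT; rewrite probability_setT /atomic.
under eq_bigr do rewrite diracT mule1.
by rewrite sumEFin => -[].
Qed.

Lemma atomic_nonempty x : P x -> exists a : S, true.
Proof.
move=> Px; apply: contrapT => /forallNP S0; have /eqP := atomic_sum1 Px.
by rewrite big1 => [|a _]; [rewrite eq_sym oner_eq0|have := S0 a].
Qed.

Lemma atomic_integral x (f : V -> R) : P x -> {within P, continuous f} ->
  \int[B x]_(z in P) f z = \sum_a p a x * f (val a).
Proof.
move=> Px cf; have [a0 _] := atomic_nonempty Px.
by apply: (Rintegral_atomic a0) => // [a|A mA]; [exact: p0|exact: Bp].
Qed.

Lemma atomic_barycenter x : P x -> barycenter (B x) = \sum_a p a x *: val a.
Proof.
move=> Px; apply/rowP => i; rewrite mxE atomic_integral//.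
  by rewrite summxE; apply: eq_bigr => a _; rewrite mxE.
by apply: continuous_subspaceT => z; exact: coord_continuous.
Qed.

Lemma atomic_grad_integral x (f : contfun P) (K : 'M[R]_m) : P x ->
  vintegral (B x) P (fun z => f z *: (K *m (z - x)^T)^T) =
  \sum_a (p a x * f (val a)) *: ((val a - x) *m K^T).
Proof.
move=> Px; apply/rowP => i; rewrite mxE summxE.
have KE (z : V) : (f z *: (K *m (z - x)^T)^T) 0 i =
    f z * (dotp (row i K) z - dotp (row i K) x).
  rewrite trmx_mul trmxK mxE -dotpBr; congr (_ * _).
  by rewrite mxE; apply: eq_bigr => j _; rewrite !mxE mulrC.
rewrite atomic_integral//.
  by apply: eq_bigr => a _; rewrite trmx_mul trmxK [X in _ * X]mxE [RHS]mxE mulrA.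
rewrite (funext KE); apply/subspace_continuousP => z Pz.
apply: cvgM; first by have /subspace_continuousP := @contfun_cont _ _ _ f; exact.
apply: cvgB; last exact: cvg_cst.
by apply: cvg_within_filter; exact: dotp_continuousr.
Qed.

End AtomicBernstein.

(** * Continuous functions separating the points of [S] *)

Section Hat.
Context {R : realType} {m : nat}.
Local Notation V := 'rV[R]_m.
Variables (P : set V) (S : {fset V}).

(** Lagrange interpolation with distances in place of linear factors: integrating this function
    against a measure carried by [S] extracts the mass at [a]. *)
Definition hat_fun (a : S) (z : V) : R :=
  \prod_(b | b != a) (`|z - val b| / `|val a - val b|).

Lemma hat_fun_continuous a : {within P, continuous (hat_fun a)}.
Proof.
apply: continuous_subspaceT; apply: continuous_big => [|b _ z].
  by move=> [u v]; exact: mul_continuous.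
apply: (@cvgM _ _ (nbhs z)); last exact: cvg_cst.
apply: (@cvg_norm _ _ _ (nbhs z)).
by apply: cvgB; [exact: cvg_id|exact: cvg_cst].
Qed.

Definition hat (a : S) : contfun P := ContFun (@hat_fun_continuous a).

Lemma hatE a b : hat a (val b) = (b == a)%:R.
Proof.
rewrite /= /hat_fun; have [->|ba] := eqVneq b a.
  apply: big1 => d da; rewrite divff// normr_eq0 subr_eq0.
  by apply: contra_neq da => /val_inj.
by rewrite (bigD1 b)//= subrr normr0 !mul0r.
Qed.

End Hat.

(** * From weights to a Bernstein measure *)

Section Existence.
Context {R : realType} {m : nat}.
Local Notation V := 'rV[R]_m.
Variables (S : {fset V}) (c : S -> R).
Local Notation P := (convex_hull [set` S]).
Hypothesis P0 : P° !=set0.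
Hypothesis c0 : forall a, 0 < c a.

Let cP : closed P := @convex_hull_closed R m S.

Let SP : [set` S] `<=` P := @sub_gen_smallest _ _ _.

Lemma B_Sc_prob_on : exists B : V -> prob_on P, is_B_Sc c B.
Proof.
have bary x := @m_Sc_barycentric R m S c P0 c0 x.
have [a0 _] := hull_nonempty P0.
have ex x : P x -> exists b : prob_on P, forall A : set borelV, b A = B_Sc P c x A.
  move=> /bary[m0 m1 _].
  have [nu nuE] := atomic_probability_ex a0 m0 m1.
  have nuP : nu P = 1%E.
    rewrite nuE /atomic -[RHS]/(1%:E) -m1 -sumEFin; apply: eq_bigr => a _.
    by rewrite diracE mem_set ?mule1//; apply: SP; exact: fsvalP.
  by exists (ProbOn nuP) => A; exact: nuE.
(* [b0] is the value taken by [B] outside [P]. *)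
have [x0 Px0] := P0; have [b0 _] := ex _ (interior_subset Px0).
have /choice[B HB] x : exists b : prob_on P, P x ->
    forall A : set borelV, b A = B_Sc P c x A.
  by have [/ex[b bE]|NP] := pselect (P x); [exists b|exists b0].
by exists B => x Px A _; exact: HB.
Qed.

Variables (B : V -> prob_on P).
Hypothesis BE : is_B_Sc c B.

Let p a x := m_Sc P c a x.

Let p0 a x : P x -> 0 <= p a x.
Proof. by move=> /(m_Sc_barycentric P0 c0)[]. Qed.

Let Bp x : P x -> forall A, measurable A -> B x A = atomic (p ^~ x) A.
Proof. by move=> Px A mA; exact: BE. Qed.

Let dens a x := weight c (tau_Sc c x) a.

Let p_dens a x : P° x -> p a x = dens a x.
Proof. by move=> Px; have [_ /(_ x Px)] := m_ScP P0 c0 a. Qed.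

Lemma Bop_B_Sc (f : contfun P) x : P x -> Bop B f x = \sum_a p a x * f (val a).
Proof. by move=> Px; apply: atomic_integral => //; exact: contfun_cont. Qed.

Lemma Bop_B_Sc_continuous (f : contfun P) : {within P, continuous (Bop B f)}.
Proof.
apply/subspace_continuousP => x Px; rewrite [X in _ --> X]Bop_B_Sc//.
have H : \sum_a p a y * f (val a) @[y --> within P (nbhs x)] -->
    \sum_a p a x * f (val a).
  apply: cvg_finsum => a; apply: cvgM; last exact: cvg_cst.
  by have [/subspace_continuousP/(_ x Px)] := m_ScP P0 c0 a.
apply: cvg_trans H; apply: near_eq_cvg.
by apply: (@filterE _ (nbhs x)) => y Py; exact/esym/Bop_B_Sc.
Qed.

Lemma B_Sc_bernstein : bernstein_measure B.
Proof.
have oP : open P° by exact: open_interior.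
have BdE (f : contfun P) x : P° x -> \sum_a dens a x * f (val a) = Bop B f x.
  move=> Px; rewrite Bop_B_Sc; last exact: interior_subset.
  by apply: eq_bigr => a _; rewrite p_dens.
split.
- exact: weak_star_continuous Bop_B_Sc_continuous.
- move=> x Px; rewrite (atomic_barycenter cP SP p0 Bp Px).
  by have [_ _] := m_Sc_barycentric P0 c0 Px.
- move=> f; split; last exact: Bop_B_Sc_continuous.
  move=> k; apply: (eq_Ck_on oP (BdE f)); apply: Ck_on_sum => // a.
  apply: Ck_onM => //; last exact: Ck_on_cst.
  by have [+ _] := dens_invcov_Ck P0 c0 k; exact.
(* The choice of [K] is read off [derive_dens]: it is the derivative of [tau_Sc], symmetric as the
   inverse of a covariance. *)
exists (fun x => invmx (cov c (tau_Sc c x))); split.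
- by move=> x _; rewrite trmx_inv cov_sym.
- move=> k; apply: Ck_on_mx => // i j.
  by have [_ +] := dens_invcov_Ck P0 c0 k; exact.
move=> f x Px; rewrite (atomic_grad_integral cP SP p0 Bp)//; last exact: interior_subset.
apply/rowP => i; rewrite mxE summxE.
have nP : nbhs x P° by exact: open_nbhs_nbhs.
have d a : is_derive x (delta_mx 0 i : V) (fun x => dens a x * f (val a))
    ((dens a x * dotp (val a - x) (delta_mx 0 i *m invmx (cov c (tau_Sc c x)))) *
     f (val a)).
  have dd : is_derive x (delta_mx 0 i : V) (dens a)
      (dens a x * dotp (val a - x) (delta_mx 0 i *m invmx (cov c (tau_Sc c x)))).
    apply: DeriveDef; last exact: derive_dens.
    by apply: diff_derivable; exact: differentiable_dens.
  have := is_deriveZ (f (val a)) dd; rewrite /GRing.scale /= mulrC => H.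
  by under eq_fun do rewrite mulrC.
transitivity ('D_(delta_mx 0 i) (fun x => \sum_a dens a x * f (val a)) x).
  apply: near_eq_derive.
  by apply: (@filterS _ (nbhs x) _ _ _ _ nP) => y Py; exact/esym/BdE.
rewrite (@derive_val _ _ _ _ _ _ _ (is_derive_finsum d)).
apply: eq_bigr => a _; rewrite mxE p_dens// -mulrA [_ * f _]mulrC mulrA.
congr (_ * _); rewrite -[RHS]dotp_delta dotp_mulmx trmxK.
by [].
Qed.

Lemma B_Sc_finitely_supported : finitely_supported B S.
Proof.
have [a0 _] := hull_nonempty P0.
have sub x : P x -> supp (B x) `<=` [set` S].
  move=> Px z suppz; apply: contrapT => zS.
  have oS : open (~` [set` S] : set V) by apply: closed_openC; exact: fset_closed.
  have := suppz _ oS zS; rewrite Bp//; last exact: borel_open.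
  by rewrite atomic_compl_supp ltxx.
split=> // x Px; apply/seteqP; split.
  by apply: sub; exact: interior_subset.
move=> a aS U oU Ua; pose a' : S := FSetSub aS.
rewrite Bp; [|exact: interior_subset|exact: borel_open].
have t0 b : 0 < p b x by rewrite p_dens//; exact: weight_gt0.
rewrite /atomic (bigD1 a')//= diracE mem_set// mule1.
apply: (@lt_le_trans _ _ (p a' x)%:E); first by rewrite lte_fin.
rewrite leeDl// sume_ge0// => b _; rewrite mule_ge0 ?lee_fin// ltW//.
Qed.

End Existence.

(** * From a finitely supported Bernstein measure to its weights *)

Section Uniqueness.
Context {R : realType} {m : nat}.
Local Notation V := 'rV[R]_m.
Variables (P : set V) (S : {fset V}) (B : V -> prob_on P).
Hypothesis coP : compact P.
Hypothesis convP : @convex_set R V P.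
Hypothesis P0 : P° !=set0.
Hypothesis bernB : bernstein_measure B.
Hypothesis suppB : finitely_supported B S.

Let cP : closed P.
Proof. by apply: compact_closed coP; exact: norm_hausdorff. Qed.

Let SP : [set` S] `<=` P.
Proof. by have [] := suppB. Qed.

Let mass (a : S) (x : V) : R := fine (B x [set val a]).

Let mass_ge0 a x : P x -> 0 <= mass a x.
Proof. by move=> _; exact: fine_ge0. Qed.

Let B_atomic x : P x -> forall A, measurable A -> B x A = atomic (mass ^~ x) A.
Proof.
move=> Px A mA; apply: probability_atomic mA.
have [_ _ /(_ x Px) suppS] := suppB.
exact: (supp_sub_null coP (prob_on_carried (B x)) suppS).
Qed.

(** The mass at [a] rewritten as the image of a continuous function under [Bop], so that smoothness,
    continuity and the gradient formula of a Bernstein measure apply to it. *)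
Let M (a : S) : V -> R := Bop B (hat P a).

Let M_mass a x : P x -> M a x = mass a x.
Proof.
move=> Px; rewrite /M /Bop (atomic_integral cP SP mass_ge0 B_atomic Px); last first.
  exact: contfun_cont.
rewrite (bigD1 a)//= [hat_fun _ _](hatE P a a) eqxx mulr1 big1 ?addr0// => b ba.
by rewrite [hat_fun _ _](hatE P a b) (negbTE ba) mulr0.
Qed.

Let M_atomic x : P x -> forall A, measurable A -> B x A = atomic (M ^~ x) A.
Proof.
move=> Px A mA; rewrite B_atomic//; apply: eq_bigr => a _.
by rewrite M_mass.
Qed.

Let M_ge0 a x : P x -> 0 <= M a x.
Proof. by move=> Px; rewrite M_mass//; exact: mass_ge0. Qed.

Let M_barycentric x : P x -> barycentric x (M ^~ x).
Proof.
move=> Px; split; first by move=> a; exact: M_ge0.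
  exact: (atomic_sum1 M_atomic).
by rewrite -(atomic_barycenter cP SP M_ge0 M_atomic Px); have [_ -> //] := bernB.
Qed.

Let M_gt0 a x : P° x -> 0 < M a x.
Proof.
move=> Px; have [_ /(_ x Px) suppS _] := suppB.
have Px' := interior_subset Px.
have : supp (B x) (val a) by rewrite suppS; exact: fsvalP.
have oU := @open_isolate R m S a.
move=> /(_ _ oU); rewrite M_atomic//; last exact: borel_open.
by rewrite atomic_isolate lte_fin; apply; right.
Qed.

Let M_differentiable a x : P° x -> differentiable (M a) x.
Proof.
move=> Px; have [_ _ /(_ (hat P a))[sm _] _] := bernB.
by have [/(_ x Px)] := sm 1%N.
Qed.

(** The masses are barycentric coordinates over [S] of each interior point; density of [P°] in [P]
    and closedness of the hull do the rest. *)
Lemma support_hull : convex_hull [set` S] = P.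
Proof.
apply: convex_hull_interior_sub => // x /interior_subset Px.
by apply/convex_hull_fsetP; exists (M ^~ x); exact: M_barycentric.
Qed.

(** In the gradient condition for the hat function of [a], the integral reduces to the single term
    of [a]. *)
Lemma derive_mass : exists K : V -> 'M[R]_m, forall a x v, P° x ->
  'D_v (M a) x = M a x * dotp ((val a - x) *m (K x)^T) v.
Proof.
have [_ _ _ [K [_ _ gradK]]] := bernB; exists K => a x v Px.
have Px' := interior_subset Px.
rewrite derive_grad; last exact: M_differentiable.
rewrite gradK// (atomic_grad_integral cP SP M_ge0 M_atomic)//.
rewrite (bigD1 a)//= [hat_fun _ _](hatE P a a) eqxx mulr1 big1 => [|b ba].
  by rewrite addr0 dotpZl.
by rewrite [hat_fun _ _](hatE P a b) (negbTE ba) mulr0 scale0r.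
Qed.

Variable a0 : S.

(** Comparing with the reference point [a0] cancels [x] from the logarithmic gradient
    [K (a - x)]. *)
Let L a x := ln (M a x) - ln (M a0 x).

Let L_differentiable a x : P° x -> differentiable (L a) x.
Proof.
move=> Px; apply: differentiableB; apply: differentiable_ln_comp;
  by [exact: M_gt0|exact: M_differentiable].
Qed.

(* A linear relation between the vectors [a - a0] kills the gradient of the
   corresponding combination of log-ratios, since that of [L a] is [K (a - a0)]. *)
Lemma log_ratio_relation (l : S -> R) x y : P° x -> P° y ->
  \sum_a l a *: (val a - val a0) = 0 ->
  \sum_a l a * (L a y - L a x) = 0.
Proof.
move=> Px Py l0; have [K dM] := derive_mass.
pose Phi z := \sum_a l a * L a z.
suff PhiE : Phi x = Phi y.
  by under eq_bigr do rewrite mulrBr; rewrite sumrB -/(Phi x) -/(Phi y) PhiE subrr.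
have dL a z v : P° z -> is_derive z v (L a) (dotp ((val a - val a0) *m (K z)^T) v).
  move=> Pz; apply: DeriveDef; first exact/diff_derivable/L_differentiable.
  rewrite deriveB; first last.
  - by apply/diff_derivable/differentiable_ln_comp; [exact: M_gt0|exact: M_differentiable].
  - by apply/diff_derivable/differentiable_ln_comp; [exact: M_gt0|exact: M_differentiable].
  rewrite (derive_ln_comp v (M_gt0 a Pz) (M_differentiable a Pz)).
  rewrite (derive_ln_comp v (M_gt0 a0 Pz) (M_differentiable a0 Pz)).
  rewrite !dM// !mulKf ?lt0r_neq0 ?M_gt0// -dotpBl -mulmxBl.
  by rewrite opprB addrA subrK.
apply: (@derive0_cst _ _ P°).
- move=> t t01; have [->|t0] := eqVneq t 0; first by rewrite scale0r add0r subr0 scale1r.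
  apply: interior_convexl => //; first exact: interior_subset.
  by case/andP: t01 => t0' ->; rewrite lt_def t0 t0'.
- move=> z Pz; apply: differentiable_finsum => a; apply: differentiableM.
    exact: differentiable_cst.
  exact: L_differentiable.
- move=> z v Pz.
  have d a : is_derive z v (fun z => l a * L a z)
      (l a * dotp ((val a - val a0) *m (K z)^T) v).
    by have := is_deriveZ (l a) (dL a z v Pz); exact.
  rewrite (@derive_val _ _ _ _ _ _ _ (is_derive_finsum d)).
  have -> : \sum_a l a * dotp ((val a - val a0) *m (K z)^T) v =
      dotp ((\sum_a l a *: (val a - val a0)) *m (K z)^T) v.
    rewrite mulmx_suml dotp_suml; apply: eq_bigr => a _.
    by rewrite -scalemxAl dotpZl.
  by rewrite l0 mul0mx dotp0l.
Qed.

(** The weights are the mass ratios at a base point [x0]. By [log_ratio_relation] the increments of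
    [L] from [x0] to [x] satisfy all linear relations between the [a - a0], so [dotp_solution]
    yields [t]. *)
Lemma mass_weight x0 x : P° x0 -> P° x -> exists t : V, forall a,
  M a x = weight (fun a => expR (L a x0)) t a.
Proof.
move=> Px0 Px.
have [t Lt] := dotp_solution (fun l l0 => log_ratio_relation Px0 Px l0).
(* The factor common to all masses; as these sum to 1, it is the inverse of the partition sum
   [Z]. *)
exists t => a; pose k := M a0 x * expR (- dotp (val a0) t).
have k0 : 0 < k by rewrite mulr_gt0 ?expR_gt0 ?M_gt0.
have ME b : M b x = k * (expR (L b x0) * expR (dotp (val b) t)).
  rewrite -{1}[M b x]lnK ?posrE ?M_gt0//.
  have -> : ln (M b x) = ln (M a0 x) + (- dotp (val a0) t + (L b x0 + dotp (val b) t)).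
    have := Lt b; rewrite dotpBl {1}/L.
    move: (ln (M b x)) (ln (M a0 x)) (L b x0) (dotp (val b) t) (dotp (val a0) t).
    by move=> *; lra.
  by rewrite !expRD lnK ?posrE ?M_gt0// mulrA.
have [_ M1 _] := M_barycentric (interior_subset Px).
set Z := \sum_b expR (L b x0) * expR (dotp (val b) t).
have kZ : k * Z = 1 by rewrite -M1 mulr_sumr; apply: eq_bigr => b _; rewrite ME.
have Z0 : Z != 0 by apply/eqP => Z0; have /eqP := kZ; rewrite Z0 mulr0 eq_sym oner_eq0.
by rewrite /weight ME -/Z -[k](mulfK Z0) kZ mul1r mulrC.
Qed.

Lemma bernstein_is_B_Sc : exists c : S -> R, (forall a, 0 < c a) /\ is_B_Sc c B.
Proof.
have [x0 Px0] := P0; pose c a := expR (L a x0).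
have c0 a : 0 < c a by exact: expR_gt0.
exists c; split=> //.
have SE := support_hull.
have PS : (convex_hull [set` S])° !=set0 by rewrite SE.
have M_weight a x : P° x -> M a x = weight c (tau_Sc c x) a.
  move=> Px; have [t Mt] := mass_weight Px0 Px.
  (* The masses have barycenter [x] and are the weights at [t], so [mu_Sc c t = x]. *)
  suff -> : tau_Sc c x = t by exact: Mt.
  rewrite -[RHS](mu_ScK PS c0); congr (tau_Sc c _).
  have [_ _ {1}<-] := M_barycentric (interior_subset Px).
  by apply: eq_bigr => b _; rewrite Mt.
move=> x Px A mA; rewrite M_atomic//; apply: eq_bigr => a _; congr (_%:E * _)%E.
have [cm mE] := m_ScP PS c0 a; rewrite SE in cm mE.
(* The identity is known on [P°], and both sides are continuous on [P]. *)
apply: (@eq_within_interior _ _ _ P) => //.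
- exact: interior_convex_dense.
- by have [_ _ /(_ (hat P a))[]] := bernB.
- by move=> y Py; rewrite M_weight// mE.
Qed.

End Uniqueness.

Theorem theorem2p10 (R : realType) (m : nat) (P : set 'rV[R]_m)
    (polyP : polytope P) (intP : P° !=set0) :
  (forall (S : {fset 'rV[R]_m}) (c : S -> R),
     [set` S] `<=` P -> convex_hull [set` S] = P -> (forall a, 0 < c a) ->
     exists B : 'rV[R]_m -> prob_on P,
       [/\ is_B_Sc c B, bernstein_measure B & finitely_supported B S])
  /\
  (forall (B : 'rV[R]_m -> prob_on P) (S : {fset 'rV[R]_m}),
     bernstein_measure B -> finitely_supported B S ->
     exists c : S -> R, (forall a, 0 < c a) /\ is_B_Sc c B).
Proof.
split=> [S c _ SP c0|B S bernB suppB].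
  subst P; have [B BE] := B_Sc_prob_on intP c0.
  exists B; split=> //; first exact: B_Sc_bernstein BE.
  exact: B_Sc_finitely_supported BE.
have [F PF] := polyP.
have coP : compact P by rewrite PF; exact: convex_hull_compact.
have convP : @convex_set R 'rV[R]_m P by rewrite PF; exact: convex_hull_convex.
(* A reference point for the log-ratios: [S] is nonempty because its hull [P] has interior
   points. *)
have [a0 _] : exists a0 : S, true.
  by apply: (@hull_nonempty R m S); rewrite (support_hull coP convP intP bernB suppB).
exact: (bernstein_is_B_Sc coP convP intP bernB suppB a0).
Qed.
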